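(* Let $X$ be a real affine variety and $\pi' : X' \to X$ be the normalization morphism. Then $$ \mathcal{K}^{R+}(X(\mathbb{R})) \simeq \Bigl\{ p\in\mathbb{R}[X'] \;\Big|\; \forall z_1,z_2 \in (\pi'_{\mathbb{C}})^{-1}(X(\mathbb{R})),\ \pi'_{\mathbb{C}}(z_1) = \pi'_{\mathbb{C}}(z_2) \implies p_{\mathbb{C}}(z_1) = p_{\mathbb{C}}(z_2) \Bigr\}, $$ the isomorphism being the one sending $f$ to the image in $\mathbb{R}[X']$ of $f\circ\pi^{R+}_{\mathbb{R}}\in\mathbb{R}[X^{R+}]$.
   Context: Rings are commutative with unit. An ideal $I$ of a ring $A$ is real if $\sum a_i^2\in I$ (finite sum) implies that every $a_i\in I$; $\mathrm{R\text{-}Spec}(A)$ is the set of real prime ideals of $A$. For an integral extension $A\hookrightarrow B$, put $A_B^{R+}=\{b\in B\mid \forall \mathfrak{p}\in\mathrm{R\text{-}Spec}(A),\ b_{\mathfrak p}\in A_{\mathfrak p}+\mathrm{Rad}(B_{\mathfrak p})\}$, where $B_{\mathfrak p}=(A\setminus\mathfrak p)^{-1}B$, $b_{\mathfrak p}$ is the image of $b$ in $B_{\mathfrak p}$, and $\mathrm{Rad}$ is the Jacobson radical. A real affine variety is $X=\mathrm{Spec}(\mathbb{R}[X])$ with $\mathbb{R}[X]\simeq\mathbb{R}[x_1,\dots,x_n]/I$ and $I$ a real ideal ($X$ may be reducible). $X(\mathbb{R})\subset\mathbb{R}^n$ is the set of real points and $X(\mathbb{C})\subset\mathbb{C}^n$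 the set of complex points. $\mathcal{K}(X)$ is the total ring of fractions of $\mathbb{R}[X]$. The normalization $X'$ has coordinate ring $\mathbb{R}[X']$, the integral closure of $\mathbb{R}[X]$ in $\mathcal{K}(X)$; $\pi'_{\mathbb{C}}:X'(\mathbb{C})\to X(\mathbb{C})$ is the map induced by $\pi'$, and for $p\in\mathbb{R}[X']$, $p_{\mathbb{C}}$ is the induced function on $X'(\mathbb{C})$. The R-seminormalization of $X$ is $X^{R+}=\mathrm{Spec}\big(\mathbb{R}[X]^{R+}_{\mathbb{R}[X']}\big)$, with canonical morphism $\pi^{R+}:X^{R+}\to X$ and induced map $\pi^{R+}_{\mathbb{R}}:X^{R+}(\mathbb{R})\to X(\mathbb{R})$. $\mathcal{K}^{R+}(X(\mathbb{R}))$ is the ring of functions $f:X(\mathbb{R})\to\mathbb{R}$ such that $f\circ\pi^{R+}_{\mathbb{R}}\in\mathbb{R}[X^{R+}]$, i.e. such that $f\circ\pi^{R+}_{\mathbb{R}}$ is the function on $X^{R+}(\mathbb{R})$ given by an element of $\mathbb{R}[X^{R+}]$ (this element is unique since $X^{R+}(\mathbb{R})$ is Zariski dense in $X^{R+}$). *)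

(* Defs.v *)
From HB Require Import structures.
From mathcomp Require Import all_boot all_order all_algebra.
From mathcomp Require Import generic_quotient ring.
From mathcomp.multinomials Require Import mpoly.
From mathcomp Require Import boolp classical_sets functions reals.
From mathcomp.real_closed Require Import complex.

Set Implicit Arguments.
Unset Strict Implicit.
Unset Printing Implicit Defensive.

Import GRing.Theory.
Local Open Scope ring_scope.
Local Open Scope quotient_scope.
Local Open Scope classical_set_scope.

(* Rings are comPzRingType, so that the zero ring (which occurs as the        *)
(* coordinate ring of the empty variety) is allowed; MathComp's ideal         *)
(* structures are restricted to proper ideals of nonzero rings, hence the     *)
(* Prop-valued notions below.                                                 *)

Section Ideals.
Variable A : comPzRingType.
Implicit Types I J : set A.

Definition is_ideal I :=
  [/\ I 0, forall x y, I x -> I y -> I (x + y) & forall a x, I x -> I (a * x)].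

Definition is_real_ideal I :=
  is_ideal I /\
  forall s : seq A, I (\sum_(a <- s) a ^+ 2) -> forall a, a \in s -> I a.

Definition is_prime_ideal I :=
  [/\ is_ideal I, ~ I 1 & forall x y, I (x * y) -> I x \/ I y].

Definition is_maximal_ideal I :=
  [/\ is_ideal I, ~ I 1 &
      forall J, is_ideal J -> ~ J 1 -> I `<=` J -> J = I].

Definition jacobson_radical : set A :=
  [set x | forall m, is_maximal_ideal m -> m x].

Record real_spec := RealSpec {
  rspec_set :> A -> Prop;
  rspec_prime : is_prime_ideal rspec_set;
  rspec_real : is_real_ideal rspec_set
}.

Lemma jacobson_radical_ideal : is_ideal jacobson_radical.
Proof.
split=> [m [[]] //|x y Jx Jy m mm|a x Jx m mm]; case: (mm) => -[m0 mD mM] _ _.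
  by apply: mD; [apply: Jx | apply: Jy].
by apply: mM; apply: Jx.
Qed.

Lemma is_idealN I x : is_ideal I -> I x -> I (- x).
Proof. by case=> _ _ IM Ix; rewrite -mulN1r; apply: IM. Qed.

End Ideals.

Record subring (B : comPzRingType) := Subring {
  subring_set :> B -> Prop;
  subring1 : subring_set 1;
  subringB : forall x y, subring_set x -> subring_set y -> subring_set (x - y);
  subringM : forall x y, subring_set x -> subring_set y -> subring_set (x * y)
}.

Section SubringRing.
Variables (B : comPzRingType) (S : subring B).

Definition subring_type := {x : B | `[< S x >]}.

Lemma subring_type_closed : subring_closed (fun x : B => `[< S x >]).
Proof.
split; first exact/asboolP/subring1.
  by move=> x y /asboolP Sx /asboolP Sy; apply/asboolP/subringB.
by move=> x y /asboolP Sx /asboolP Sy; apply/asboolP/subringM.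
Qed.

HB.instance Definition _ := SubChoice.on subring_type.
HB.instance Definition _ :=
  GRing.SubChoice_isSubComPzRing.Build B (fun x : B => `[< S x >]) subring_type
    subring_type_closed.

Definition in_subring (x : B) (Sx : S x) : subring_type :=
  exist (fun x : B => `[< S x >]) x (asboolT Sx).

End SubringRing.

Coercion subring_type : subring >-> Sortclass.

(* Restriction of the codomain of a ring morphism to a subring containing     *)
(* its image.                                                                 *)
Section Corestriction.
Variables (A B : comPzRingType) (S : subring B) (i : {rmorphism A -> B}).
Hypothesis iS : forall a, S (i a).

Definition corestr (a : A) : S := in_subring (iS a).

Lemma corestr_zmod : zmod_morphism corestr.
Proof. by move=> a b; apply: val_inj; rewrite /= rmorphB. Qed.

Lemma corestr_monoid : monoid_morphism corestr.
Proof.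
by split=> [|a b]; apply: val_inj; rewrite /= ?rmorph1 ?rmorphM.
Qed.

HB.instance Definition _ := GRing.isZmodMorphism.Build A S corestr corestr_zmod.
HB.instance Definition _ :=
  GRing.isMonoidMorphism.Build A S corestr corestr_monoid.

End Corestriction.

Record mulset (A : comPzRingType) := MulSet {
  mulset_set :> A -> Prop;
  mulset1 : mulset_set 1;
  mulsetM : forall x y, mulset_set x -> mulset_set y -> mulset_set (x * y)
}.

(* The localization of A at S: pairs (a, s) modulo                            *)
(* (a, s) ~ (b, t) iff u (a t - b s) = 0 for some u in S.                     *)
Section Localization.
Variables (A : comPzRingType) (S : mulset A).

Definition denom := {s : A | `[< S s >]}.
Definition mk_denom (s : A) (Ss : S s) : denom :=
  exist (fun s : A => `[< S s >]) s (asboolT Ss).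

Definition dval (s : denom) : A := sval s.

Lemma denomP (s : denom) : S (dval s). Proof. by case: s => s /= /asboolP. Qed.

Definition denomM (s t : denom) : denom :=
  mk_denom (mulsetM (denomP s) (denomP t)).
Definition denom1 : denom := mk_denom (mulset1 S).

Lemma dvalM s t : dval (denomM s t) = dval s * dval t. Proof. by []. Qed.
Lemma dval1 : dval denom1 = 1. Proof. by []. Qed.

Definition loc_equiv (x y : A * denom) : bool :=
  `[< exists2 u, S u & u * (x.1 * dval y.2) = u * (y.1 * dval x.2) >].

Lemma loc_equiv_refl : reflexive loc_equiv.
Proof. by move=> x; apply/asboolP; exists 1 => //; apply: mulset1. Qed.

Lemma loc_equiv_sym : ssrbool.symmetric loc_equiv.
Proof. by move=> x y; apply/asboolP/asboolP => -[u Su e]; exists u. Qed.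

Lemma loc_equiv_trans : transitive loc_equiv.
Proof.
move=> [b t] [a s] [c w] /asboolP[u Su /= e1] /asboolP[v Sv /= e2].
apply/asboolP; exists (u * v * dval t) => /=.
  by apply: mulsetM; [apply: mulsetM | apply: denomP].
have -> : u * v * dval t * (a * dval w) = (u * (a * dval t)) * v * dval w by ring.
have -> : u * v * dval t * (c * dval s) = (v * (c * dval t)) * u * dval s by ring.
by rewrite e1 -e2; ring.
Qed.

Canonical loc_equivrel :=
  EquivRel loc_equiv loc_equiv_refl loc_equiv_sym loc_equiv_trans.

Definition loc := {eq_quot loc_equivrel}.

HB.instance Definition _ := Choice.on loc.

Definition frac (a : A) (s : denom) : loc := \pi_{eq_quot loc_equivrel} (a, s).

Lemma eq_frac a s b t :
  frac a s = frac b t <-> exists2 u, S u & u * (a * dval t) = u * (b * dval s).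
Proof.
rewrite /frac; split=> [/eqP|e]; last by apply/eqP; rewrite eqmodE; apply/asboolP.
by rewrite eqmodE => /asboolP.
Qed.

Lemma eq_frac1 a s b t : a * dval t = b * dval s -> frac a s = frac b t.
Proof. by move=> e; apply/eq_frac; exists 1; [apply: mulset1 | rewrite e]. Qed.

Lemma fracW (P : loc -> Prop) : (forall a s, P (frac a s)) -> forall x, P x.
Proof. by move=> H x; rewrite -[x]reprK; case: (repr x). Qed.

Let lnum (x : loc) : A := (repr x).1.
Let lden (x : loc) : denom := (repr x).2.

Let lnumE x : frac (lnum x) (lden x) = x.
Proof. by rewrite /frac -surjective_pairing reprK. Qed.

Definition loc_add (x y : loc) : loc :=
  frac (lnum x * dval (lden y) + lnum y * dval (lden x)) (denomM (lden x) (lden y)).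
Definition loc_opp (x : loc) : loc := frac (- lnum x) (lden x).
Definition loc_mul (x y : loc) : loc :=
  frac (lnum x * lnum y) (denomM (lden x) (lden y)).

Lemma loc_addE a s b t :
  loc_add (frac a s) (frac b t) = frac (a * dval t + b * dval s) (denomM s t).
Proof.
have /eq_frac[u Su e] := lnumE (frac a s).
have /eq_frac[v Sv e'] := lnumE (frac b t).
rewrite /loc_add; move: (lnum (frac a s)) (lden (frac a s)) e => a' s' e.
move: (lnum (frac b t)) (lden (frac b t)) e' => b' t' e'.
apply/eq_frac; exists (u * v); first exact: mulsetM.
rewrite ?dvalM; transitivity ((u * (a' * dval s)) * v * dval t * dval t' +
  (v * (b' * dval t)) * u * dval s * dval s'); first by ring.
by rewrite e e'; ring.
Qed.

Lemma loc_oppE a s : loc_opp (frac a s) = frac (- a) s.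
Proof.
have /eq_frac[u Su e] := lnumE (frac a s).
by apply/eq_frac; exists u => //; rewrite !mulNr !mulrN e.
Qed.

Lemma loc_mulE a s b t :
  loc_mul (frac a s) (frac b t) = frac (a * b) (denomM s t).
Proof.
have /eq_frac[u Su e] := lnumE (frac a s).
have /eq_frac[v Sv e'] := lnumE (frac b t).
rewrite /loc_mul; move: (lnum (frac a s)) (lden (frac a s)) e => a' s' e.
move: (lnum (frac b t)) (lden (frac b t)) e' => b' t' e'.
apply/eq_frac; exists (u * v); first exact: mulsetM.
rewrite ?dvalM; transitivity ((u * (a' * dval s)) * (v * (b' * dval t))); first by ring.
by rewrite e e'; ring.
Qed.

Lemma loc_addA : associative loc_add.
Proof.
elim/fracW=> a s; elim/fracW=> b t; elim/fracW=> c w.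
by rewrite !loc_addE; apply: eq_frac1; rewrite ?(dvalM, dval1); ring.
Qed.

Lemma loc_addC : commutative loc_add.
Proof.
elim/fracW=> a s; elim/fracW=> b t.
by rewrite !loc_addE; apply: eq_frac1; rewrite ?(dvalM, dval1); ring.
Qed.

Lemma loc_add0 : left_id (frac 0 denom1) loc_add.
Proof.
by elim/fracW=> a s; rewrite loc_addE; apply: eq_frac1; rewrite ?(dvalM, dval1); ring.
Qed.

Lemma loc_addN : left_inverse (frac 0 denom1) loc_opp loc_add.
Proof.
elim/fracW=> a s; rewrite loc_oppE loc_addE.
by apply: eq_frac1; rewrite ?(dvalM, dval1); ring.
Qed.

HB.instance Definition _ :=
  GRing.isZmodule.Build loc loc_addA loc_addC loc_add0 loc_addN.

Lemma loc_mulA : associative loc_mul.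
Proof.
elim/fracW=> a s; elim/fracW=> b t; elim/fracW=> c w.
by rewrite !loc_mulE; apply: eq_frac1; rewrite ?(dvalM, dval1); ring.
Qed.

Lemma loc_mulC : commutative loc_mul.
Proof.
elim/fracW=> a s; elim/fracW=> b t.
by rewrite !loc_mulE; apply: eq_frac1; rewrite ?(dvalM, dval1); ring.
Qed.

Lemma loc_mul1 : left_id (frac 1 denom1) loc_mul.
Proof.
by elim/fracW=> a s; rewrite loc_mulE; apply: eq_frac1; rewrite ?(dvalM, dval1); ring.
Qed.

Lemma loc_mulD : left_distributive loc_mul +%R.
Proof.
elim/fracW=> a s; elim/fracW=> b t; elim/fracW=> c w.
rewrite /GRing.add /= !(loc_addE, loc_mulE).
by apply: eq_frac1; rewrite ?(dvalM, dval1); ring.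
Qed.

HB.instance Definition _ :=
  GRing.Zmodule_isComPzRing.Build loc loc_mulA loc_mulC loc_mul1 loc_mulD.

Lemma fracB a s b t :
  frac a s - frac b t = frac (a * dval t - b * dval s) (denomM s t).
Proof.
rewrite [frac a s - _](_ : _ = loc_add (frac a s) (loc_opp (frac b t))) //.
by rewrite loc_oppE loc_addE mulNr.
Qed.

Lemma fracM a s b t : frac a s * frac b t = frac (a * b) (denomM s t).
Proof. exact: loc_mulE. Qed.

Definition to_loc (a : A) : loc := frac a denom1.

Lemma to_loc_zmod : zmod_morphism to_loc.
Proof.
move=> a b; rewrite fracB.
by apply: eq_frac1; rewrite ?(dvalM, dval1); ring.
Qed.

Lemma to_loc_monoid : monoid_morphism to_loc.
Proof.
by split=> // a b; rewrite fracM; apply: eq_frac1; rewrite ?(dvalM, dval1); ring.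
Qed.

HB.instance Definition _ := GRing.isZmodMorphism.Build A loc to_loc to_loc_zmod.
HB.instance Definition _ :=
  GRing.isMonoidMorphism.Build A loc to_loc to_loc_monoid.

End Localization.

Section TotalFractions.
Variable A : comPzRingType.

Definition nonzerodivisor (s : A) : Prop := forall a, s * a = 0 -> a = 0.

Lemma nonzerodivisor1 : nonzerodivisor 1.
Proof. by move=> a; rewrite mul1r. Qed.

Lemma nonzerodivisorM s t :
  nonzerodivisor s -> nonzerodivisor t -> nonzerodivisor (s * t).
Proof. by move=> hs ht a; rewrite -mulrA => /hs/ht. Qed.

Definition nonzerodivisors := MulSet nonzerodivisor1 nonzerodivisorM.

Definition total_fractions : comPzRingType := loc nonzerodivisors.

End TotalFractions.

(* MathComp's integralOver requires nonzero rings; the coefficients below are *)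
(* those of a monic polynomial of degree n. A nonzero K gives integralOver.   *)
Section IntegralClosure.
Variables (A K : comPzRingType) (i : {rmorphism A -> K}).

Definition integral_over (x : K) : Prop :=
  exists (n : nat) (c : 'I_n -> A), x ^+ n + \sum_(k < n) i (c k) * x ^+ k = 0.

Lemma integral_over_id a : integral_over (i a).
Proof.
exists 1%N, (fun=> - a).
by rewrite big_ord1 expr0 expr1 mulr1 rmorphN addrN.
Qed.

End IntegralClosure.

Lemma integral_overE (A K : comNzRingType) (i : {rmorphism A -> K}) (x : K) :
  integral_over i x <-> integralOver i x.
Proof.
split=> [[n [c e]]|[p pm rx]].
  pose q : {poly A} := \poly_(k < n) (if insub k is Some j then c j else 0).
  have szq : (size q < size ('X^n : {poly A}))%N.
    by rewrite size_polyXn ltnS size_poly.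
  exists ('X^n + q); first by rewrite monicE lead_coefDl // lead_coefXn.
  rewrite /root rmorphD /= map_polyXn hornerD hornerXn -[X in _ == X]e.
  apply/eqP; congr (_ + _); rewrite (@horner_coef_wide _ n); last first.
    by rewrite (leq_trans (size_poly _ _)) // size_poly.
  by apply: eq_bigr => k _; rewrite coef_map coef_poly ltn_ord valK.
exists (size p).-1, (fun k => p`_k).
have sp : size p = (size p).-1.+1.
  by rewrite prednK // size_poly_gt0 monic_neq0.
have := eqP rx; rewrite (@horner_coef_wide _ (size p).-1.+1); last first.
  by rewrite -sp size_poly.
rewrite big_ord_recr /= addrC coef_map.
rewrite -lead_coefE (monicP pm) [X in X * _](rmorph1 i) mul1r => e.
rewrite -[RHS]e; congr (_ + _).
by apply: eq_bigr => k _; rewrite coef_map.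
Qed.

Section IntegralClosureRing.
Variables (A K : comPzRingType) (i : {rmorphism A -> K}).

Lemma integral_over_closed (x y : K) :
  integral_over i x -> integral_over i y ->
  integral_over i (x - y) /\ integral_over i (x * y).
Proof.
have [K0|K1] := eqVneq (1 : K) 0.
  move=> _ _; have z (u : K) : u = i 0 by rewrite rmorph0 -[u]mul1r K0 mul0r.
  by rewrite (z (x - y)) (z (x * y)); split; apply: integral_over_id.
have A1 : (1 : A) != 0.
  by apply: contraNneq K1 => A0; rewrite -(rmorph1 i) A0 rmorph0.
pose K' : comNzRingType := HB.pack (GRing.ComPzRing.sort K)
  (GRing.ComPzRing.class K) (GRing.PzSemiRing_isNonZero.Build K K1).
pose A' : comNzRingType := HB.pack (GRing.ComPzRing.sort A)
  (GRing.ComPzRing.class A) (GRing.PzSemiRing_isNonZero.Build A A1).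
pose i' : {rmorphism A' -> K'} := i.
move=> /(@integral_overE A' K' i') ix /(@integral_overE A' K' i') iy.
by split; apply/(@integral_overE A' K' i');
  [apply: integral_sub | apply: integral_mul].
Qed.

Lemma integral_over1 : integral_over i 1.
Proof. by rewrite -(rmorph1 i); apply: integral_over_id. Qed.

Definition integral_closure : subring K :=
  Subring integral_over1
    (fun x y ix iy => (integral_over_closed ix iy).1)
    (fun x y ix iy => (integral_over_closed ix iy).2).

End IntegralClosureRing.

(* The subring A_B^{R+} of B, for i : A -> B (meant to be injective and       *)
(* integral). B_p is the localization of B at i(A \ p), and A_p is viewed in  *)
(* B_p as the set of the fractions i(a) / i(s), with s outside p.             *)
Section RSeminormalization.
Variables (A B : comPzRingType) (i : {rmorphism A -> B}).

Section AtPrime.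
Variable p : real_spec A.

Definition compl_image : set B := [set b | exists2 s, ~ p s & b = i s].

Lemma compl_image1 : compl_image 1.
Proof. by exists 1; [case: (rspec_prime p) | rewrite rmorph1]. Qed.

Lemma compl_imageM x y : compl_image x -> compl_image y -> compl_image (x * y).
Proof.
move=> [s ps ->] [t pt ->]; exists (s * t); last by rewrite rmorphM.
by have [_ _ h] := rspec_prime p; case/h.
Qed.

Definition compl_mulset := MulSet compl_image1 compl_imageM.

Lemma compl_mulsetP s : ~ p s -> compl_mulset (i s).
Proof. by exists s. Qed.

Definition loc_at : comPzRingType := loc compl_mulset.

Definition base_loc_at : set loc_at :=
  [set x | exists a s (ps : ~ p s),
     x = frac (i a) (mk_denom (compl_mulsetP ps))].

Definition in_Rplus_at (b : B) : Prop :=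
  exists x y : loc_at,
    [/\ base_loc_at x, jacobson_radical y & to_loc compl_mulset b = x + y].

Lemma base_loc_atM x y : base_loc_at x -> base_loc_at y -> base_loc_at (x * y).
Proof.
move=> [a [s [ps ->]]] [b [t [pt ->]]].
have pst : ~ p (s * t) by have [_ _ h] := rspec_prime p; case/h.
exists (a * b), (s * t), pst; rewrite fracM.
by apply: eq_frac1; rewrite dvalM /dval /= !rmorphM.
Qed.

Lemma base_loc_atB x y : base_loc_at x -> base_loc_at y -> base_loc_at (x - y).
Proof.
move=> [a [s [ps ->]]] [b [t [pt ->]]].
have pst : ~ p (s * t) by have [_ _ h] := rspec_prime p; case/h.
exists (a * t - b * s), (s * t), pst; rewrite fracB.
by apply: eq_frac1; rewrite dvalM /dval /= !(rmorphB, rmorphM).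
Qed.

Lemma in_Rplus_at_id a : in_Rplus_at (i a).
Proof.
have [_ p1 _] := rspec_prime p.
exists (to_loc compl_mulset (i a)), 0; split; last by rewrite addr0.
  by exists a, 1, p1; apply: eq_frac1; rewrite /= rmorph1.
by case: (jacobson_radical_ideal loc_at).
Qed.

Lemma in_Rplus_atB b c : in_Rplus_at b -> in_Rplus_at c -> in_Rplus_at (b - c).
Proof.
move=> [x [y [ax ry eb]]] [x' [y' [ax' ry' ec]]].
exists (x - x'), (y - y'); split; first exact: base_loc_atB.
  have J := jacobson_radical_ideal loc_at; have [_ JD _] := J.
  by apply: JD => //; exact: is_idealN J ry'.
transitivity (to_loc compl_mulset b - to_loc compl_mulset c).
  exact: rmorphB.
by rewrite eb ec; ring.
Qed.

Lemma in_Rplus_atM b c : in_Rplus_at b -> in_Rplus_at c -> in_Rplus_at (b * c).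
Proof.
move=> [x [y [ax ry eb]]] [x' [y' [ax' ry' ec]]].
exists (x * x'), (x * y' + (x' + y') * y); split; first exact: base_loc_atM.
  have [_ JD JM] := jacobson_radical_ideal loc_at.
  by apply: JD; apply: JM.
transitivity (to_loc compl_mulset b * to_loc compl_mulset c).
  exact: rmorphM.
by rewrite eb ec; ring.
Qed.

End AtPrime.

Definition in_Rplus (b : B) : Prop := forall p : real_spec A, in_Rplus_at p b.

Lemma in_Rplus_id a : in_Rplus (i a).
Proof. by move=> p; apply: in_Rplus_at_id. Qed.

Lemma in_Rplus1 : in_Rplus 1.
Proof. by rewrite -(rmorph1 i); apply: in_Rplus_id. Qed.

Definition Rplus : subring B :=
  Subring in_Rplus1
    (fun b c hb hc p => in_Rplus_atB (hb p) (hc p))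
    (fun b c hb hc p => in_Rplus_atM (hb p) (hc p)).

End RSeminormalization.

(* A real affine variety, given by its coordinate ring together with a        *)
(* presentation R[x_1, ..., x_n] / I, where I = ker(pres) is a real ideal.    *)
Record real_variety (R : realType) := RealVariety {
  nvars : nat;
  coord_ring : comPzRingType;
  pres : {rmorphism {mpoly R[nvars]} -> coord_ring};
  pres_surj : forall a, exists P, pres P = a;
  pres_real : is_real_ideal [set P : {mpoly R[nvars]} | pres P = 0]
}.

(* The F-points, for an R-algebra j : R -> F, as zeros of I in F^n.           *)
Section Points.
Variables (R : realType) (X : real_variety R).
Variables (F : comNzRingType) (j : {rmorphism R -> F}).

Definition vpoint :=
  {x : 'I_(nvars X) -> F | forall P, pres X P = 0 -> mmap j x P = 0}.

(* F-points of Spec B, for a coord_ring X-algebra i : coord_ring X -> B:      *)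
(* the morphisms of R-algebras B -> F.                                        *)
Record spoint (B : comPzRingType) (i : {rmorphism coord_ring X -> B}) :=
  SPoint {
    spoint_fun :> {rmorphism B -> F};
    spoint_base : forall r, spoint_fun (i (pres X (mpolyC (nvars X) r))) = j r
  }.

Variables (B : comPzRingType) (i : {rmorphism coord_ring X -> B}).

Definition proj_coord (z : spoint i) (k : 'I_(nvars X)) : F := z (i (pres X 'X_k)).

Lemma proj_coordP (z : spoint i) P :
  pres X P = 0 -> mmap j (proj_coord z) P = 0.
Proof.
move=> P0; rewrite -[RHS](rmorph0 z) -[in RHS](rmorph0 i) -P0 {P0}.
rewrite {2}[P]mpolyE !rmorph_sum /=; apply: eq_bigr => m _.
rewrite -mul_mpolyC !rmorphM /= spoint_base; congr (_ * _).
rewrite mpolyXE_id !rmorph_prod /mmap1; apply: eq_bigr => k _.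
by rewrite !rmorphXn.
Qed.

Definition proj (z : spoint i) : vpoint :=
  exist (fun x => forall P, pres X P = 0 -> mmap j x P = 0)
    (proj_coord z) (@proj_coordP z).

End Points.

Definition RtoC (R : realType) : {rmorphism R -> R[i]} := real_complex R.
Arguments RtoC {R}.

Section Varieties.
Variables (R : realType) (X : real_variety R).

Definition real_points := vpoint X (idfun : {rmorphism R -> R}).
Definition complex_points := vpoint X RtoC.

Lemma real_point_complex (x : real_points) P :
  pres X P = 0 -> mmap RtoC (fun k => RtoC (sval x k)) P = 0.
Proof.
move=> /(svalP x P) e; transitivity (RtoC (mmap idfun (sval x) P)); last first.
  by rewrite e rmorph0.
rewrite rmorph_sum.
apply: eq_bigr => m _; rewrite rmorphM; congr (_ * _).
by rewrite rmorph_prod; apply: eq_bigr => k _; rewrite rmorphXn.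
Qed.

Definition complex_of_real_point (x : real_points) : complex_points :=
  exist (fun x => forall P, pres X P = 0 -> mmap RtoC x P = 0)
    (fun k => RtoC (sval x k)) (@real_point_complex x).

Definition fraction_ring : comPzRingType := total_fractions (coord_ring X).

Definition to_fraction_ring : {rmorphism coord_ring X -> fraction_ring} :=
  to_loc (nonzerodivisors (coord_ring X)).

(* R[X'] with R[X] -> R[X'], then R[X^{R+}] with R[X] -> R[X^{R+}] *)
Definition norm_ring : comPzRingType := integral_closure to_fraction_ring.

Definition to_norm_ring : {rmorphism coord_ring X -> norm_ring} :=
  @corestr _ _ (integral_closure to_fraction_ring) _
    (integral_over_id to_fraction_ring).

Definition Rsn_ring : comPzRingType := Rplus to_norm_ring.

Definition to_Rsn_ring : {rmorphism coord_ring X -> Rsn_ring} :=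
  @corestr _ _ (Rplus to_norm_ring) _ (in_Rplus_id to_norm_ring).

Definition norm_complex_points := spoint RtoC to_norm_ring.

Definition norm_projC : norm_complex_points -> complex_points := @proj _ _ _ _ _ _.

Definition Rsn_real_points :=
  spoint (idfun : {rmorphism R -> R}) to_Rsn_ring.

Definition Rsn_projR : Rsn_real_points -> real_points := @proj _ _ _ _ _ _.

(* f o pi^{R+}_R is the function on X^{R+}(R) given by q.                     *)
Definition pullback_is (f : real_points -> R) (q : Rsn_ring) : Prop :=
  forall y : Rsn_real_points, f (Rsn_projR y) = y q.

Definition KRplus_pred (f : real_points -> R) : Prop :=
  exists q : Rsn_ring, pullback_is f q.

Lemma KRplus1 : KRplus_pred 1.
Proof. by exists 1 => y; rewrite rmorph1. Qed.

Lemma KRplusB f g : KRplus_pred f -> KRplus_pred g -> KRplus_pred (f - g).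
Proof. by move=> [q hq] [r hr]; exists (q - r) => y; rewrite rmorphB -hq -hr. Qed.

Lemma KRplusM f g : KRplus_pred f -> KRplus_pred g -> KRplus_pred (f * g).
Proof. by move=> [q hq] [r hr]; exists (q * r) => y; rewrite rmorphM -hq -hr. Qed.

Definition KRplus : subring (real_points -> R) := Subring KRplus1 KRplusB KRplusM.

Definition constant_on_real_fibers (p : norm_ring) : Prop :=
  forall z1 z2 : norm_complex_points,
    (norm_projC @^-1` range complex_of_real_point) z1 ->
    (norm_projC @^-1` range complex_of_real_point) z2 ->
    norm_projC z1 = norm_projC z2 -> z1 p = z2 p.

Lemma constant_on_real_fibers1 : constant_on_real_fibers 1.
Proof. by move=> z1 z2 _ _ _; rewrite !rmorph1. Qed.

Lemma constant_on_real_fibersB p q : constant_on_real_fibers p ->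
  constant_on_real_fibers q -> constant_on_real_fibers (p - q).
Proof.
by move=> hp hq z1 z2 h1 h2 e; rewrite !rmorphB (hp _ _ h1 h2 e) (hq _ _ h1 h2 e).
Qed.

Lemma constant_on_real_fibersM p q : constant_on_real_fibers p ->
  constant_on_real_fibers q -> constant_on_real_fibers (p * q).
Proof.
by move=> hp hq z1 z2 h1 h2 e; rewrite !rmorphM (hp _ _ h1 h2 e) (hq _ _ h1 h2 e).
Qed.

Definition real_fiber_constant : subring norm_ring :=
  Subring constant_on_real_fibers1 constant_on_real_fibersB
    constant_on_real_fibersM.

End Varieties.

(* Main.v *)
From HB Require Import structures.
From mathcomp Require Import all_boot all_order all_algebra.
From mathcomp Require Import generic_quotient zify ring lra.
From mathcomp.multinomials Require Import mpoly.
From mathcomp Require Import boolp classical_sets filter reals.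
From mathcomp.real_closed Require Import complex qe_rcf_th.
Require Import Defs.

(** Let A = R[X], B = R[X'] and C = R[X^{R+}], so that A is contained in C, C
in B, and B is integral over A.  The theorem says that C consists of the
elements p of B that are constant on the fibres of X'(C) -> X(C) over real
points, and that an element of C is the same thing as a function on X(R).

An element q of C is constant on these fibres ([Rplus_real_value]).  Let m be
the maximal ideal of A at a real point x.  A complex point z of X' over x
extends to B_m, and the kernel of the extension is a maximal ideal because the
image is a subring of C that contains R.  So the extension kills Rad(B_m), and
z(q) is the value at x of a fraction in A_m; it is real and depends on x only.

Conversely, let p be constant on these fibres and P a real prime of A
([fiber_constant_Rplus], through [generically_rational]).  Take F in A[T] of
least degree with leading coefficient outside P such that F(p) lies in every
prime of B over P.  If F has degree one, p lies in A_P + Rad(B_P).  If its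
degree is d > 1, minimality forces (d - 1) F'^2 - d F F'' to be nonzero modulo
P, and this polynomial is zero for multiples of (T - c)^d.  The real
Nullstellensatz provides a real point x in the zero set of P where the leading
coefficient of F and some coefficient of (d - 1) F'^2 - d F F'' are nonzero, so
that F_x has two distinct complex roots.  By minimality again every relation
G(p) = 0 specializes to a relation G_x satisfied by these roots; hence, B being
integral over A, there are two complex points of X' over x at which p takes
these two values ([extend_to_complex]), a contradiction.

Every real point of X lifts to exactly one real point of X^{R+}
([Rsn_point_exists], [Rsn_point_unique]), because complex points of X' over it
take real values on C.  Since the real points of X are Zariski dense, so are
those of X^{R+} ([Rsn_points_dense]), and f determines q and conversely.

The real Nullstellensatz is proved along the lines of Artin and Lang.  Let I be
a real ideal and a an element outside it.  Zorn's lemma gives an ordering of a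
residue field at a prime containing I but not a ([prime_cone_exists]).  This
ordered field embeds into a real closed one ([real_closure_exists]), which
contains a zero of I that is not a zero of a.  Such a point is moved to
the reals one coordinate at a time ([artin_lang]): the existence of one
unknown subject to sign conditions can be decided by computing in the ordered
field generated by the coefficients ([existential_transfer]), and an ultrapower
of R contains an ordered copy of the field generated by the other
coordinates.  Hilbert's basis theorem makes the number of conditions finite. *)

Set Implicit Arguments.
Unset Strict Implicit.
Unset Printing Implicit Defensive.

Import Order.TTheory GRing.Theory Num.Theory.
Local Open Scope ring_scope.
Local Open Scope quotient_scope.
Local Open Scope classical_set_scope.

(** * Ordered fields presented by representatives *)

Section PresentedField.
Variables (T : Type) (le : T -> T -> Prop).
Variables (zero one : T) (add mul : T -> T -> T) (opp inv : T -> T).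

Definition le_eqv x y := le x y /\ le y x.
Local Notation "x ~~ y" := (le_eqv x y) (at level 70).

(** The axioms hold up to the equivalence of the preorder only: a field element
has many names, be they pairs of a numerator and a denominator, formal terms
or sequences. *)
Record ordered_field_presentation : Prop := OrderedFieldPresentation {
  pf_trans : forall y x z, le x y -> le y z -> le x z;
  pf_total : forall x y, le x y \/ le y x;
  pf_addA : forall x y z, add x (add y z) ~~ add (add x y) z;
  pf_addC : forall x y, add x y ~~ add y x;
  pf_add0 : forall x, add zero x ~~ x;
  pf_addN : forall x, add (opp x) x ~~ zero;
  pf_mulA : forall x y z, mul x (mul y z) ~~ mul (mul x y) z;
  pf_mulC : forall x y, mul x y ~~ mul y x;
  pf_mul1 : forall x, mul one x ~~ x;
  pf_mulD : forall x y z, mul (add x y) z ~~ add (mul x z) (mul y z);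
  pf_one : ~ (one ~~ zero);
  pf_mulV : forall x, ~ (x ~~ zero) -> mul (inv x) x ~~ one;
  pf_leD : forall z x y, le x y -> le (add x z) (add y z);
  pf_leM : forall x y, le zero x -> le zero y -> le zero (mul x y);
  pf_mul_eqv : forall z x y, x ~~ y -> mul x z ~~ mul y z
}.

Hypothesis pf : ordered_field_presentation.

Let CT : choiceType := {classic T}.

Definition pf_equiv (x y : CT) : bool := `[< le_eqv x y >].

Lemma pf_equiv_refl : reflexive pf_equiv.
Proof. by move=> x; apply/asboolP; split; case: (pf_total pf x x). Qed.

Lemma pf_equiv_sym : ssrbool.symmetric pf_equiv.
Proof. by move=> x y; apply/asboolP/asboolP => -[]. Qed.

Lemma pf_equiv_trans : transitive pf_equiv.
Proof.
move=> y x z /asboolP[xy yx] /asboolP[yz zy]; apply/asboolP.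
by split; apply: (pf_trans pf) (y) _ _ _ _.
Qed.

Canonical pf_equivrel :=
  EquivRel pf_equiv pf_equiv_refl pf_equiv_sym pf_equiv_trans.

Definition pfield := {eq_quot pf_equivrel}.
HB.instance Definition _ := Choice.on pfield.

Definition pf_pi (x : T) : pfield := \pi_{eq_quot pf_equivrel} (x : CT).
Definition pf_repr (q : pfield) : T := repr q.

Lemma pf_piK q : pf_pi (pf_repr q) = q.
Proof. exact: reprK. Qed.

Lemma pf_piP x y : pf_pi x = pf_pi y <-> x ~~ y.
Proof.
rewrite /pf_pi; split=> [/eqP|e]; first by rewrite eqmodE => /asboolP.
by apply/eqP; rewrite eqmodE; apply/asboolP.
Qed.

Lemma pf_reprP x : pf_repr (pf_pi x) ~~ x.
Proof. by apply/pf_piP; rewrite pf_piK. Qed.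

Lemma pf_pi_ind (P : pfield -> Prop) : (forall x, P (pf_pi x)) -> forall q, P q.
Proof. by move=> H q; rewrite -[q]pf_piK. Qed.

Definition pf_add q r := pf_pi (add (pf_repr q) (pf_repr r)).
Definition pf_mul q r := pf_pi (mul (pf_repr q) (pf_repr r)).
Definition pf_opp q := pf_pi (opp (pf_repr q)).
Definition pf_le (q r : pfield) : bool := `[< le (pf_repr q) (pf_repr r) >].

Lemma pf_addl z x y : x ~~ y -> pf_pi (add x z) = pf_pi (add y z).
Proof. by case=> xy yx; apply/pf_piP; split; apply: pf_leD. Qed.

Lemma pf_addE x y : pf_add (pf_pi x) (pf_pi y) = pf_pi (add x y).
Proof.
rewrite /pf_add (pf_addl _ (pf_reprP x)) ((pf_piP _ _).2 (pf_addC pf _ _)).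
by rewrite (pf_addl _ (pf_reprP y)); apply/pf_piP; apply: pf_addC.
Qed.

Lemma pf_mulE x y : pf_mul (pf_pi x) (pf_pi y) = pf_pi (mul x y).
Proof.
rewrite /pf_mul ((pf_piP _ _).2 (pf_mul_eqv pf _ (pf_reprP x))).
rewrite ((pf_piP _ _).2 (pf_mulC pf _ _)).
rewrite ((pf_piP _ _).2 (pf_mul_eqv pf _ (pf_reprP y))).
exact/pf_piP/pf_mulC.
Qed.

Lemma pf_leE x y : pf_le (pf_pi x) (pf_pi y) <-> le x y.
Proof.
have [xy yx] := pf_reprP x; have [zt tz] := pf_reprP y.
split=> [/asboolP h|h].
  by apply: (pf_trans pf yx); apply: (pf_trans pf h).
by apply/asboolP; apply: (pf_trans pf xy); apply: (pf_trans pf h).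
Qed.

Fact pf_addqA : associative pf_add.
Proof.
elim/pf_pi_ind=> x; elim/pf_pi_ind=> y; elim/pf_pi_ind=> z.
by rewrite !pf_addE; apply/pf_piP/pf_addA.
Qed.
Fact pf_addqC : commutative pf_add.
Proof.
elim/pf_pi_ind=> x; elim/pf_pi_ind=> y.
by rewrite !pf_addE; apply/pf_piP/pf_addC.
Qed.
Fact pf_addq0 : left_id (pf_pi zero) pf_add.
Proof. by elim/pf_pi_ind=> x; rewrite pf_addE; apply/pf_piP/pf_add0. Qed.
Fact pf_addqN : left_inverse (pf_pi zero) pf_opp pf_add.
Proof.
by move=> x; rewrite -{2}[x]pf_piK pf_addE; apply/pf_piP/pf_addN.
Qed.
HB.instance Definition _ :=
  GRing.isZmodule.Build pfield pf_addqA pf_addqC pf_addq0 pf_addqN.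

Fact pf_mulqA : associative pf_mul.
Proof.
elim/pf_pi_ind=> x; elim/pf_pi_ind=> y; elim/pf_pi_ind=> z.
by rewrite !pf_mulE; apply/pf_piP/pf_mulA.
Qed.
Fact pf_mulqC : commutative pf_mul.
Proof.
elim/pf_pi_ind=> x; elim/pf_pi_ind=> y.
by rewrite !pf_mulE; apply/pf_piP/pf_mulC.
Qed.
Fact pf_mulq1 : left_id (pf_pi one) pf_mul.
Proof. by elim/pf_pi_ind=> x; rewrite pf_mulE; apply/pf_piP/pf_mul1. Qed.
Fact pf_mulqD : left_distributive pf_mul +%R.
Proof.
elim/pf_pi_ind=> x; elim/pf_pi_ind=> y; elim/pf_pi_ind=> z.
rewrite /GRing.add /= !(pf_addE, pf_mulE).
exact/pf_piP/pf_mulD.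
Qed.
Fact pf_oneq : pf_pi one != 0.
Proof. by apply/eqP => /pf_piP; apply: pf_one. Qed.
HB.instance Definition _ :=
  GRing.Zmodule_isComNzRing.Build pfield pf_mulqA pf_mulqC pf_mulq1 pf_mulqD
    pf_oneq.

Definition pf_inv (q : pfield) : pfield :=
  if q == 0 then 0 else pf_pi (inv (pf_repr q)).
Fact pf_mulqV (q : pfield) : q != 0 -> pf_inv q * q = 1.
Proof.
move=> q0; rewrite /pf_inv (negPf q0) -{2}[q]pf_piK.
rewrite [LHS]pf_mulE; apply/pf_piP; apply: (pf_mulV pf) => /pf_piP.
by rewrite pf_piK; apply/eqP.
Qed.
Fact pf_invq0 : pf_inv 0 = 0.
Proof. by rewrite /pf_inv eqxx. Qed.
HB.instance Definition _ :=
  GRing.ComNzRing_isField.Build pfield pf_mulqV pf_invq0.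

Lemma pf_piD x y : pf_pi (add x y) = pf_pi x + pf_pi y.
Proof. by rewrite -pf_addE. Qed.
Lemma pf_piM x y : pf_pi (mul x y) = pf_pi x * pf_pi y.
Proof. by rewrite -pf_mulE. Qed.

Fact pf_leqD (q r s : pfield) : pf_le q r -> pf_le (q + s) (r + s).
Proof.
elim/pf_pi_ind: q => x; elim/pf_pi_ind: r => y; elim/pf_pi_ind: s => z.
by rewrite -!pf_piD => /pf_leE h; apply/pf_leE/pf_leD.
Qed.
Fact pf_leq_trans (r q s : pfield) : pf_le q r -> pf_le r s -> pf_le q s.
Proof. by move=> /asboolP h /asboolP h'; apply/asboolP/(pf_trans pf h). Qed.

Definition pf_norm (q : pfield) : pfield := if pf_le 0 q then q else - q.
Definition pf_lt (q r : pfield) : bool := (r != q) && pf_le q r.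

Fact pf_le0_add (q r : pfield) : pf_le 0 q -> pf_le 0 r -> pf_le 0 (q + r).
Proof.
move=> q0 r0; apply: (pf_leq_trans r0).
by have := pf_leqD r q0; rewrite add0r.
Qed.
Fact pf_le0_mul (q r : pfield) : pf_le 0 q -> pf_le 0 r -> pf_le 0 (q * r).
Proof.
elim/pf_pi_ind: q => x; elim/pf_pi_ind: r => y.
by rewrite -!pf_piM => /pf_leE h /pf_leE h'; apply/pf_leE/pf_leM.
Qed.
Fact pf_le_anti (q r : pfield) : pf_le q r -> pf_le r q -> q = r.
Proof.
elim/pf_pi_ind: q => x; elim/pf_pi_ind: r => y /pf_leE h /pf_leE h'.
exact/pf_piP.
Qed.
Fact pf_le0_anti (q : pfield) : pf_le 0 q -> pf_le q 0 -> q = 0.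
Proof. by move=> h h'; apply: pf_le_anti. Qed.
Fact pf_sub_ge0 (q r : pfield) : pf_le 0 (r - q) = pf_le q r.
Proof.
apply/idP/idP => [/(pf_leqD q)|/(pf_leqD (- q))]; first by rewrite add0r subrK.
by rewrite subrr.
Qed.
Fact pf_le_total (q r : pfield) : pf_le q r || pf_le r q.
Proof.
by apply/orP; case: (pf_total pf (pf_repr q) (pf_repr r)) => h;
  [left|right]; apply/asboolP.
Qed.
Fact pf_le0_total (q : pfield) : pf_le 0 q || pf_le q 0.
Proof. exact: pf_le_total. Qed.
Fact pf_normN (q : pfield) : pf_norm (- q) = pf_norm q.
Proof.
have le0N r : pf_le 0 (- r) = pf_le r 0 by rewrite -(pf_sub_ge0 r) sub0r.
rewrite /pf_norm le0N opprK.
case: ifP => h; case: ifP => h' //; last by have := pf_le_total q 0; rewrite h h'.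
by rewrite (pf_le0_anti h' h) oppr0.
Qed.
Fact pf_ge0_norm (q : pfield) : pf_le 0 q -> pf_norm q = q.
Proof. by rewrite /pf_norm => ->. Qed.
Fact pf_lt_def (q r : pfield) : pf_lt q r = (r != q) && pf_le q r.
Proof. by []. Qed.

HB.instance Definition _ :=
  Num.IntegralDomain_isLeReal.Build pfield pf_le0_add pf_le0_mul pf_le0_anti
    pf_sub_ge0 pf_le0_total pf_normN pf_ge0_norm pf_lt_def.

(** Residue fields of prime cones, real closures and ultrapowers are all
instances of this quotient. *)
Theorem presented_field : exists (F : realFieldType) (pi : T -> F),
  [/\ forall q, exists x, pi x = q,
      forall x y, pi x <= pi y <-> le x y,
      pi zero = 0 /\ pi one = 1 &
      (forall x y, pi (add x y) = pi x + pi y) /\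
      (forall x y, pi (mul x y) = pi x * pi y)].
Proof.
exists (pfield : realFieldType), pf_pi; split.
- by move=> q; exists (pf_repr q); apply: pf_piK.
- exact: pf_leE.
- by [].
- by split; [apply: pf_piD|apply: pf_piM].
Qed.

End PresentedField.

(** * Prime cones and their ordered fields *)

(** Only nonempty chains have to be bounded, since A0 bounds the empty one. *)
Lemma zorn_above (T : Type) (P : set (set T)) (A0 : set T) : P A0 ->
    (forall F : set (set T), (exists X, F X) -> F `<=` P -> total_on F subset ->
      P (\bigcup_(X in F) X)) ->
  exists A, [/\ A0 `<=` A, P A & forall B, A `<=` B -> P B -> B = A].
Proof.
move=> PA0 Pchain; pose P' X := P (A0 `|` X).
have [F FP' Ftot|A [PA Amax]] := @Zorn_bigcup T P'.
  have [F0|] := pselect (exists X, F X); last first.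
    move=> F0; rewrite /P' (_ : _ `|` _ = A0) //; apply/seteqP; split=> x.
      by case=> // -[X FX _]; case: F0; exists X.
    by left.
  have [X0 FX0] := F0.
  rewrite /P'.
  have -> : A0 `|` \bigcup_(X in F) X = \bigcup_(Y in [set A0 `|` X | X in F]) Y.
    apply/seteqP; split=> x.
      case=> [A0x|[X FX Xx]]; first by exists (A0 `|` X0); [exists X0|left].
      by exists (A0 `|` X); [exists X|right].
    by case=> _ [X FX <-] [A0x|Xx]; [left|right; exists X].
  apply: Pchain; first by exists (A0 `|` X0); exists X0.
    by move=> _ [X FX <-]; apply: FP'.
  move=> _ _ [X FX <-] [Y FY <-]; case: (Ftot X Y FX FY) => XY; [left|right].
    exact: setUS.
  exact: setUS.
exists (A0 `|` A); split=> [x|//|B AB PB]; first by left.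
 apply/seteqP; split=> // x Bx; apply: contrapT => nx.
apply: (Amax B); last first.
  rewrite /P' (_ : A0 `|` B = B) //; apply/setUidPr => y A0y.
  by apply: AB; left.
split=> [y Ay|BA]; first by apply: AB; right.
by apply: nx; right; apply: BA.
Qed.

Section PrimeCones.
Variable A : comPzRingType.
Implicit Types (Q T : set A) (a b x y : A).

Definition preordering Q :=
  [/\ forall x y, Q x -> Q y -> Q (x + y),
      forall x y, Q x -> Q y -> Q (x * y) & forall x, Q (x ^+ 2)].

Definition support Q x := Q x /\ Q (- x).

(** A point of the real spectrum of A: the elements that are nonnegative for an
ordering of the residue field at the prime [support Q]. *)
Record prime_cone Q : Prop := PrimeCone {
  cone_pre : preordering Q;
  cone_total : forall x, Q x \/ Q (- x);
  cone_prime : forall x y, support Q (x * y) -> support Q x \/ support Q y;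
  cone_proper : ~ Q (-1)
}.

Lemma preordering_expn Q e m : preordering Q -> Q e -> Q (e ^+ m).
Proof.
case=> QD QM QX Qe; elim: m => [|m IH]; last by rewrite exprS; apply: QM.
by rewrite expr0 -(expr1n _ 2); apply: QX.
Qed.

Lemma preordering_extend Q a : preordering Q ->
  preordering [set x | exists y z, [/\ Q y, Q z & x = y + a * z]].
Proof.
move=> [QD QM QX]; have Q0 : Q 0 by have := QX 0; rewrite expr0n.
have QX' x y : Q y -> Q (x ^+ 2 * y) by move=> Qy; apply: QM (QX _) Qy.
split=> [x y [y1 [z1 [Qy1 Qz1 ->]]] [y2 [z2 [Qy2 Qz2 ->]]]
  |x y [y1 [z1 [Qy1 Qz1 ->]]] [y2 [z2 [Qy2 Qz2 ->]]]|x].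
- by exists (y1 + y2), (z1 + z2); split; [apply: QD|apply: QD|ring].
- exists (y1 * y2 + a ^+ 2 * (z1 * z2)), (y1 * z2 + y2 * z1); split; last by ring.
    by apply: QD; [apply: QM|apply: QX'; apply: QM].
  by apply: QD; apply: QM.
- by exists (x ^+ 2), 0; split=> //; rewrite mulr0 addr0.
Qed.

(** A preordering that is maximal among those which contain T and no -e^m is a
prime cone.  If neither x nor -x could be adjoined, the obstructions
-e^m = y + x z and -e^k = y' - x z' would multiply to one inside Q; the same
product shows that the support is prime.  The role of e is to keep a chosen
element nonzero in the residue field; e = 1 gives the usual statement. *)
Theorem prime_cone_exists T e : preordering T -> T e ->
    (forall m, ~ T (- e ^+ m)) ->
  exists Q, [/\ T `<=` Q, prime_cone Q & ~ Q (- e)].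
Proof.
move=> preT Te Tm.
pose P Q := preordering Q /\ forall m, ~ Q (- e ^+ m).
have [||Q [TQ [preQ Qm] Qmax]] := @zorn_above A P T; first by [].
  move=> F [X0 FX0] FP Ftot; split; last first.
    by move=> m [X /FP[_ /(_ m)]].
  split=> [x y [X FX Xx] [Y FY Yy]|x y [X FX Xx] [Y FY Yy]|x].
  - case: (Ftot _ _ FX FY) => XY.
      by exists Y => //; have [[YD _ _] _] := FP _ FY; apply: YD => //; apply: XY.
    by exists X => //; have [[XD _ _] _] := FP _ FX; apply: XD => //; apply: XY.
  - case: (Ftot _ _ FX FY) => XY.
      by exists Y => //; have [[_ YM _] _] := FP _ FY; apply: YM => //; apply: XY.
    by exists X => //; have [[_ XM _] _] := FP _ FX; apply: XM => //; apply: XY.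
  - by exists X0 => //; have [[_ _ XX] _] := FP _ FX0; apply: XX.
have [QD QM QX] := preQ.
have Q0 : Q 0 by have := QX 0; rewrite expr0n.
have Qe m : Q (e ^+ m) by apply: preordering_expn => //; apply: TQ.
(* By maximality, adjoining a to Q creates some -e^m. *)
have ext a : ~ Q a -> exists m y z, [/\ Q y, Q z & - e ^+ m = y + a * z].
  move=> nQa; apply: contrapT => H.
  pose Q' := [set x | exists y z, [/\ Q y, Q z & x = y + a * z]].
  have Q'E : Q' = Q.
    apply: Qmax; first by move=> x Qx; exists x, 0; rewrite mulr0 addr0.
    split; first exact: preordering_extend.
    by move=> m [y [z [Qy Qz E]]]; apply: H; exists m, y, z.
  apply: nQa; rewrite -Q'E; exists 0, 1; split=> //; last by ring.
  by have := QX 1; rewrite expr1n.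
have tot x : Q x \/ Q (- x).
  apply: contrapT => /not_orP[/ext[m [y [z [Qy Qz E]]]] /ext[k [y' [z' [Qy' Qz' E']]]]].
  apply: (Qm (m + k)%N).
  have -> : - e ^+ (m + k) =
      e ^+ m * y' + y * e ^+ k + y * y' + x ^+ 2 * (z * z').
    have Em : e ^+ m = - (y + x * z) by rewrite -E opprK.
    have Ek : e ^+ k = - (y' + - x * z') by rewrite -E' opprK.
    by rewrite exprD Em Ek; ring.
  by do ![exact: Qe|exact: QX|assumption|apply QD|apply QM].
have nsupp x : ~ support Q x ->
    exists m y z, [/\ Q y, Q z & x ^+ 2 * z = e ^+ m + y].
  move=> /not_andP H.
  have [n [Qn nQn n2]] : exists n, [/\ Q n, ~ Q (- n) & n ^+ 2 = x ^+ 2].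
    case: H => H; last by exists x; split=> //; case: (tot x).
    by exists (- x); rewrite opprK sqrrN; split=> //; case: (tot x).
  have [m [y [z [Qy Qz E]]]] := ext _ nQn.
  exists (m + m)%N, (y * e ^+ m + e ^+ m * y + y * y), (z * z).
  split; [by do ![exact: Qe|assumption|apply QD|apply QM]|exact: QM|].
  have Em : e ^+ m = n * z - y by rewrite -[LHS]opprK E; ring.
  by rewrite -n2 exprD Em; ring.
exists Q; split=> //; last by have := Qm 1%N; rewrite expr1.
split=> //; last by have := Qm 0%N; rewrite expr0.
move=> x y [Qxy Qxy']; apply: contrapT => /not_orP[/nsupp[m [u [z [Qu Qz E]]]]].
move=> /nsupp[k [u' [z' [Qu' Qz' E']]]].
apply: (Qm (m + k)%N).
have -> : - e ^+ (m + k) = e ^+ m * u' + u * e ^+ k + u * u'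
    + (- (x * y)) * (x * y) * (z * z').
  rewrite exprD.
  have -> : - (x * y) * (x * y) * (z * z') = - ((x ^+ 2 * z) * (y ^+ 2 * z')).
    by ring.
  by rewrite E E'; ring.
by do ![exact: Qe|exact: QX|assumption|apply QD|apply QM].
Qed.

End PrimeCones.

Section ConeField.
Variables (A : comPzRingType) (Q : set A).
Hypothesis cQ : prime_cone Q.

Let QD x y : Q x -> Q y -> Q (x + y). Proof. by case: (cone_pre cQ) => + _ _; apply. Qed.
Let QM x y : Q x -> Q y -> Q (x * y). Proof. by case: (cone_pre cQ) => _ + _; apply. Qed.
Let QX x : Q (x ^+ 2). Proof. by case: (cone_pre cQ). Qed.
Let Q0 : Q 0. Proof. by have := QX 0; rewrite expr0n. Qed.
Let Q1 : Q 1. Proof. by have := QX 1; rewrite expr1n. Qed.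

Definition cone_pos x := Q x /\ ~ Q (- x).

Lemma cone_pos1 : cone_pos 1.
Proof. by split=> //; apply: (cone_proper cQ). Qed.

Lemma cone_cancel d w : cone_pos d -> Q (d * w) -> Q w.
Proof.
move=> [Qd nQd] Qdw; case: (cone_total cQ w) => // Qw.
have [|[]//|[]//] := @cone_prime _ Q cQ d w.
by split=> //; rewrite -mulrN; apply: QM.
Qed.

Lemma cone_posM x y : cone_pos x -> cone_pos y -> cone_pos (x * y).
Proof.
move=> px py; have [Qx nx] := px; have [Qy ny] := py; split; first exact: QM.
by rewrite -mulrN => /(cone_cancel px).
Qed.

Let T := (A * {x | cone_pos x})%type.
Let den (t : T) := sval t.2.
Let denP (t : T) : cone_pos (den t). Proof. by case: t => a []. Qed.
Let mk a b (pb : cone_pos b) : T := (a, exist _ b pb).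
Let le (s t : T) := Q (t.1 * den s - s.1 * den t).
Let inv_def (t : T) : exists u : T, ~ support Q t.1 ->
  t.1 * u.1 = den u * den t.
Proof.
have [h|h] := pselect (support Q t.1); first by exists t.
have [Qt|Qt] := cone_total cQ t.1.
  have p : cone_pos t.1 by split=> // nQ; apply: h.
  by exists (mk (den t) p).
have p : cone_pos (- t.1) by split=> //; rewrite opprK => nQ; apply: h.
by exists (mk (- den t) p) => _; rewrite /den /=; ring.
Qed.
Let inv (t : T) := sval (cid (inv_def t)).

Let QE (x y : A) : Q x -> x = y -> Q y. Proof. by move=> Qx <-. Qed.

Let cone_presentation : ordered_field_presentation le
  (mk 0 cone_pos1) (mk 1 cone_pos1)
  (fun s t => mk (s.1 * den t + t.1 * den s) (cone_posM (denP s) (denP t)))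
  (fun s t => mk (s.1 * t.1) (cone_posM (denP s) (denP t)))
  (fun s => mk (- s.1) (denP s)) inv.
Proof.
have eqvE s t : t.1 * den s - s.1 * den t = 0 -> le_eqv le s t.
  by move=> E; split; apply: QE Q0 _; rewrite ?E // -opprB E oppr0.
split; rewrite ?/le.
- move=> t s u st tu; apply: (cone_cancel (denP t)).
  apply: QE (QD (QM (denP u).1 st) (QM (denP s).1 tu)) _; ring.
- by move=> s t; case: (cone_total cQ (t.1 * den s - s.1 * den t)); [left|right];
    rewrite // -opprB.
- by move=> s t u; apply: eqvE; rewrite /den /=; ring.
- by move=> s t; apply: eqvE; rewrite /den /=; ring.
- by move=> s; apply: eqvE; rewrite /den /=; ring.
- by move=> s; apply: eqvE; rewrite /den /=; ring.
- by move=> s t u; apply: eqvE; rewrite /den /=; ring.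
- by move=> s t; apply: eqvE; rewrite /den /=; ring.
- by move=> s; apply: eqvE; rewrite /den /=; ring.
- by move=> s t u; apply: eqvE; rewrite /den /=; ring.
- case=> + _; rewrite /le /den /= => h; apply: (cone_proper cQ); apply: QE h _; ring.
- move=> s ns; apply: eqvE; rewrite /inv; case: cid => u /= uP.
  rewrite /den /= -/(den s) -/(den u) !mulr1 mul1r [X in _ - X]mulrC uP ?subrr //.
  move=> [Qs Qs']; apply: ns; split; rewrite /le /den /=.
    by apply: QE Qs' _; ring.
  by apply: QE Qs _; ring.
- move=> u s t st; rewrite /den /= -!/(den _).
  apply: QE (QM st (QX (den u))) _; ring.
- move=> s t s0 t0; rewrite /den /= -!/(den _).
  apply: QE (QM s0 t0) _; rewrite /den /=; ring.
- move=> u s t [st ts]; rewrite /le_eqv /le /den /= -!/(den _).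
  have [Qu|Qu] := cone_total cQ u.1.
    split; [apply: QE (QM (QM st Qu) (denP u).1) _|
            apply: QE (QM (QM ts Qu) (denP u).1) _]; rewrite /den /=; ring.
  split; [apply: QE (QM (QM ts Qu) (denP u).1) _|
          apply: QE (QM (QM st Qu) (denP u).1) _]; rewrite /den /=; ring.
Qed.

(** Denominators are taken strictly positive for Q, so that two fractions are
compared by cross products. *)
Theorem cone_field : exists (K : realFieldType) (phi : {rmorphism A -> K}),
  (forall a, 0 <= phi a <-> Q a) /\
  (forall k, exists a b, phi b != 0 /\ k = phi a / phi b).
Proof.
have [K [pi [surj piE [pi0 pi1] [piD piM]]]] := presented_field cone_presentation.
pose phi a := pi (mk a cone_pos1).
have phiD a b : phi (a + b) = phi a + phi b.
  rewrite /phi -piD; apply/le_anti/andP; split; apply/piE;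
  by rewrite /le /den /=; apply: QE Q0 _; ring.
have phi0 : phi 0 = 0 by [].
have phiB : zmod_morphism phi.
  move=> a b; apply/(addIr (phi b)); rewrite -phiD !subrK //.
have phiM : monoid_morphism phi.
  split=> // a b; rewrite /phi -piM; apply/le_anti/andP; split; apply/piE;
  by rewrite /le /den /=; apply: QE Q0 _; ring.
pose zm := GRing.isZmodMorphism.Build A K phi phiB.
pose mm := GRing.isMonoidMorphism.Build A K phi phiM.
pose phi' : {rmorphism A -> K} := HB.pack phi zm mm.
have phiE a : 0 <= phi a <-> Q a.
  rewrite -pi0 piE /le /den /=; split=> h; apply: QE h _; ring.
exists K, phi'; split=> // k.
have [[a [b pb]] <-] := surj k; exists a, b; rewrite /= -/(phi a) -/(phi b).
have b0 : phi b != 0.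
  apply/eqP => b0; case: pb => _; apply; apply/phiE.
  by rewrite -[phi (- b)]/(phi' (- b)) rmorphN /= b0 oppr0.
split=> //; apply: (mulIf b0); rewrite divfK // /phi -piM.
apply/le_anti/andP; split; apply/piE; rewrite /le /den /=;
by apply: QE Q0 _; ring.
Qed.

End ConeField.

Lemma sign_morph_eq0 (A : comPzRingType) (K F : realFieldType)
    (phi : {rmorphism A -> K}) (psi : {rmorphism A -> F}) :
  (forall a, 0 <= phi a <-> 0 <= psi a) ->
  forall a, (phi a == 0) = (psi a == 0).
Proof.
move=> h a; have h' := h (- a); rewrite !rmorphN !oppr_ge0 in h'.
rewrite !eq_le; congr (_ && _).
  by apply/idP/idP => /h'.
by apply/idP/idP => /h.
Qed.

(** Equal signs give phi and psi the same kernel, so a fraction of values of phi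
can be sent to the corresponding fraction of values of psi. *)
Lemma fraction_morphism (A : comPzRingType) (K F : realFieldType)
    (phi : {rmorphism A -> K}) (psi : {rmorphism A -> F}) :
  (forall a, 0 <= phi a <-> 0 <= psi a) ->
  (forall k, exists a b, phi b != 0 /\ k = phi a / phi b) ->
  exists i : {rmorphism K -> F},
    (forall a, i (phi a) = psi a) /\ (forall k, 0 <= k <-> 0 <= i k).
Proof.
move=> sgn fracK; have eq0 := sign_morph_eq0 sgn.
have /boolp.choice[f fP] : forall k, exists c : A * A,
    phi c.2 != 0 /\ k = phi c.1 / phi c.2.
  by move=> k; have [a [b ?]] := fracK k; exists (a, b).
pose i k := psi (f k).1 / psi (f k).2.
have iE a b : phi b != 0 -> i (phi a / phi b) = psi a / psi b.
  move=> b0; have [d0 E] := fP (phi a / phi b).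
  rewrite /i; move: (f _).1 (f _).2 d0 E => c d d0 /eqP.
  rewrite eqr_div // -!rmorphM -subr_eq0 -rmorphB eq0 rmorphB subr_eq0 !rmorphM.
  by rewrite -eqr_div -?eq0 // => /eqP.
have iB : zmod_morphism i.
  move=> x y; have [xd xE] := fP x; have [yd yE] := fP y.
  have E : x - y = phi ((f x).1 * (f y).2 - (f y).1 * (f x).2)
      / phi ((f x).2 * (f y).2).
    by rewrite {1}xE {1}yE -mulNr addf_div // rmorphB !rmorphM mulNr.
  rewrite E iE ?rmorphM ?mulf_neq0 // /i rmorphB !rmorphM -[in RHS]mulNr.
  by rewrite addf_div -?eq0 // mulNr.
have iM : monoid_morphism i.
  split.
    by rewrite -[1](divr1 1) -(rmorph1 phi) iE ?rmorph1 ?divr1 // oner_eq0.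
  move=> x y; have [xd xE] := fP x; have [yd yE] := fP y.
  rewrite {1}xE {1}yE mulf_div -!rmorphM iE ?rmorphM ?mulf_neq0 //.
  by rewrite -mulf_div.
pose zm := GRing.isZmodMorphism.Build K F i iB.
pose mm := GRing.isMonoidMorphism.Build K F i iM.
pose i' : {rmorphism K -> F} := HB.pack i zm mm.
exists i'; split=> [a|k] /=.
  by rewrite -[phi a]divr1 -(rmorph1 phi) iE ?rmorph1 ?divr1 // oner_eq0.
have [d0 {1}->] := fP k; rewrite /i.
have sq (G : realFieldType) (a b : G) : b != 0 -> (0 <= a / b) = (0 <= a * b).
  move=> b0; rewrite -(pmulr_lge0 (a / b) (_ : 0 < b ^+ 2)).
    by rewrite expr2 mulrA divfK.
  by rewrite exprn_even_gt0.
by rewrite !sq -?eq0 // -!rmorphM sgn.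
Qed.

(** * Adjoining a root where a polynomial changes sign *)

Definition order_embedding (F K : realFieldType) (i : F -> K) :=
  forall x, 0 <= x <-> 0 <= i x.

Lemma order_embedding_comp (F K L : realFieldType) (i : F -> K) (j : K -> L) :
  order_embedding i -> order_embedding j -> order_embedding (j \o i).
Proof. by move=> hi hj x; rewrite hi hj. Qed.

Section OrderEmbedding.
Variables (F K : realFieldType) (i : {rmorphism F -> K}).
Hypothesis hi : order_embedding i.

Lemma embed_le x y : (i x <= i y) = (x <= y).
Proof. by rewrite -subr_ge0 -rmorphB -[RHS]subr_ge0; apply/idP/idP => /hi. Qed.

Lemma embed_lt x y : (i x < i y) = (x < y).
Proof. by rewrite !ltNge embed_le. Qed.
End OrderEmbedding.

Lemma rmorph_poly_horner (A : comNzRingType) (B : comNzRingType)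
    (phi : {rmorphism {poly A} -> B}) p :
  phi p = (map_poly (phi \o polyC) p).[phi 'X].
Proof.
elim/poly_ind: p => [|p c IH]; first by rewrite !rmorph0 horner0.
by rewrite !rmorphD !rmorphM /= IH map_polyX map_polyC hornerMXaddC.
Qed.

Section SignChange.
Variable F : realFieldType.
Implicit Types (f g h p s : {poly F}).

(** The weights make the ordering of the extension compatible with that of F,
whose nonnegative elements need not be squares. *)
Inductive weighted_sos : {poly F} -> Prop :=
| Wsos0 : weighted_sos 0
| WsosD c g p : 0 <= c -> weighted_sos p -> weighted_sos (c *: g ^+ 2 + p).

Lemma wsos_add p q : weighted_sos p -> weighted_sos q -> weighted_sos (p + q).
Proof.
by move=> hp hq; elim: hp => [|c g r c0 _ IH]; rewrite ?add0r // -addrA; constructor.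
Qed.

Lemma wsos_mul p q : weighted_sos p -> weighted_sos q -> weighted_sos (p * q).
Proof.
move=> hp hq; elim: hp => [|c g r c0 _ IH]; first by rewrite mul0r; constructor.
rewrite mulrDl; apply: wsos_add => // {IH r p}.
elim: hq => [|d k r d0 _ IH]; first by rewrite mulr0; constructor.
have -> : (c *: g ^+ 2) * (d *: k ^+ 2 + r) =
    (c * d) *: (g * k) ^+ 2 + (c *: g ^+ 2) * r.
  by rewrite mulrDr -scalerAl -scalerAr scalerA exprMn.
by constructor=> //; apply: mulr_ge0.
Qed.

Lemma wsos_ge0 p x : weighted_sos p -> 0 <= p.[x].
Proof.
elim=> [|c g r c0 _ IH]; first by rewrite horner0.
by rewrite hornerD hornerZ horner_exp addr_ge0 // mulr_ge0 // sqr_ge0.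
Qed.

(** The squares can be reduced modulo f; the degree bound 2 (deg f) - 2 is what
makes the descent of [sign_change_proper] work. *)
Lemma wsos_mod f p : (1 < size f)%N -> weighted_sos p ->
  exists s h, [/\ weighted_sos s, (size s <= ((size f).-1).*2.-1)%N & p = s + f * h].
Proof.
move=> f1; elim=> [|c g r c0 _ [s [h [hs ss ->]]]].
  by exists 0, 0; rewrite size_poly0 mulr0 addr0; split=> //; constructor.
exists (c *: (g %% f) ^+ 2 + s), (c *: ((g %/ f) ^+ 2 * f + (g %/ f) * (g %% f) *+ 2) + h).
split; first by constructor.
  rewrite (leq_trans (size_polyD _ _)) // geq_max ss andbT.
  rewrite (leq_trans (size_scale_leq _ _)) //.
  have f0 : f != 0 by rewrite -size_poly_gt0 (leq_trans _ f1).
  have := ltn_modp g f; rewrite f0; case: (size f) f1 => [|d] //= _ lt.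
  rewrite expr2 (leq_trans (size_polyMleq _ _)) //.
  rewrite -!subn1 leq_sub2r // -addnn leq_add //.
rewrite {1}(divp_eq g f) mulrDr -!mul_polyC; ring.
Qed.

(** Descent on the degree of f.  Once s is reduced modulo f, the equation reads
f k = - (1 + s') with k of smaller degree than f.  The right-hand side is
negative at a and at b, so k changes sign because f does, and -1 = s' + k f is
an equation of the same kind for k. *)
Lemma sign_change_proper f a b s h : f.[a] * f.[b] < 0 ->
  weighted_sos s -> - 1 = s + f * h -> False.
Proof.
have [n] := ubnP (size f); elim: n f s h => // n IH f s h sf fab hs E.
have f1 : (1 < size f)%N.
  rewrite ltnNge; apply/negP => /size1_polyC fC; move: fab.
  by rewrite fC !hornerC -expr2 ltNge sqr_ge0.
have [s' [h' [hs' ss' Es]]] := wsos_mod f1 hs.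
pose k := h + h'.
have {}E : f * k = - (1 + s').
  by rewrite opprD E Es /k; ring.
have val x : f.[x] * k.[x] < 0.
  rewrite -hornerM E hornerN hornerD hornerC oppr_lt0 ltr_pwDl //.
  exact: wsos_ge0.
have k0 : k != 0 by apply: contraTneq (val a) => ->; rewrite horner0 mulr0 ltxx.
have f0 : f != 0 by rewrite -size_poly_gt0 (leq_trans _ f1).
have sk : (size k < size f)%N.
  have : (size (f * k)%R <= maxn 1 ((size f).-1).*2.-1)%N.
    rewrite E size_polyN (leq_trans (size_polyD _ _)) // size_poly1.
    by rewrite geq_max leq_maxl leq_max ss' orbT.
  rewrite size_mul //; move: (size f) (size k) f1 => [|[|m]] l //= _.
  by lia.
apply: (IH k s' f) => //; first by rewrite (leq_trans sk).
  have := val a; have := val b; have := fab; nra.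
by rewrite mulrC E; ring.
Qed.

(** By [sign_change_proper], the preordering of F[X] generated by the nonnegative
constants and by f and -f does not contain -1.  In the residue field of a prime
cone above it, the class of X is a root of f. *)
Lemma adjoin_sign_change_root f a b : f.[a] * f.[b] < 0 ->
  exists (K : realFieldType) (i : {rmorphism F -> K}) (r : K),
    order_embedding i /\ root (map_poly i f) r.
Proof.
move=> fab.
pose T := [set p | exists s h, weighted_sos s /\ p = s + f * h].
have preT : preordering T.
  split=> [_ _ [s [h [hs ->]]] [s' [h' [hs' ->]]]
    |_ _ [s [h [hs ->]]] [s' [h' [hs' ->]]]|p].
  - by exists (s + s'), (h + h'); split; [apply: wsos_add|ring].
  - exists (s * s'), (h * s' + s * h' + f * h * h').
    by split; [apply: wsos_mul|ring].
  - exists (1 *: p ^+ 2 + 0), 0; split; last by rewrite scale1r; ring.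
    by constructor; [apply: ler01|constructor].
have wC c : 0 <= c -> weighted_sos c%:P.
  move=> c0; have -> : c%:P = c *: 1 ^+ 2 + 0.
    by rewrite expr1n addr0 alg_polyC.
  by constructor; [|constructor].
have TC c : 0 <= c -> T c%:P.
  by move=> c0; exists c%:P, 0; rewrite mulr0 addr0; split=> //; apply: wC.
have [||m [s [h [hs E]]]|Q [TQ cQ _]] := @prime_cone_exists _ T 1; first by [].
- by apply: TC.
- by apply: (@sign_change_proper f a b s h) => //; rewrite -E expr1n.
have [K [phi [phiP _]]] := cone_field cQ.
have nnC c : 0 <= c -> 0 <= phi c%:P by move=> c0; apply/phiP/TQ/TC.
have phif : phi f = 0.
  apply/le_anti/andP; split; last first.
    by apply/phiP/TQ; exists 0, 1; split; [constructor|ring].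
  rewrite -oppr_ge0 -rmorphN; apply/phiP/TQ.
  by exists 0, (-1); split; [constructor|ring].
exists K, (phi \o polyC), (phi 'X); split.
  move=> c; split=> [/nnC //|/=]; rewrite leNgt => c0.
  rewrite leNgt; apply: contra c0 => c0.
  have := nnC (- c); rewrite oppr_ge0 ltW // => /(_ isT).
  rewrite polyCN rmorphN oppr_ge0 lt_neqAle => ->; rewrite andbT.
  by rewrite -[phi c%:P]/((phi \o polyC) c) fmorph_eq0 lt_eqF.
by rewrite rootE -rmorph_poly_horner phif.
Qed.

End SignChange.

(** A root r obtained from [adjoin_sign_change_root] may lie outside [a, b].  Then
X - r has constant sign on [a, b], and the quotient of f by X - r, which has
smaller degree, still changes sign there. *)
Lemma adjoin_root_between (F : realFieldType) (f : {poly F}) a b :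
  a <= b -> f.[a] * f.[b] < 0 ->
  exists (K : realFieldType) (i : {rmorphism F -> K}) (r : K),
    [/\ order_embedding i, i a <= r <= i b & root (map_poly i f) r].
Proof.
have [n] := ubnP (size f); elim: n F f a b => // n IH F f a b sf ab fab.
have [K [i [r [hi ri]]]] := adjoin_sign_change_root fab.
have [rab|nrab] := boolP (i a <= r <= i b); first by exists K, i, r.
have [g Eg] := factor_theorem _ _ ri.
have val x : i f.[x] = g.[i x] * (i x - r).
  by rewrite -horner_map Eg hornerM hornerXsubC.
have iab : i a <= i b by rewrite embed_le.
have gab : g.[i a] * g.[i b] < 0.
  have : i f.[a] * i f.[b] < 0 by rewrite -rmorphM -(rmorph0 i) embed_lt.
  rewrite !val mulrACA pmulr_llt0 //.
  move: nrab; rewrite negb_and -!ltNge => /orP[lt|lt].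
    by rewrite mulr_gt0 // subr_gt0 // (lt_le_trans lt).
  by rewrite nmulr_rgt0 // subr_lt0 // (le_lt_trans iab).
have sg : (size g < n)%N.
  have g0 : g != 0 by apply: contraTneq gab => ->; rewrite !horner0 mulr0 ltxx.
  have := congr1 (fun p : {poly K} => size p) Eg.
  by rewrite size_map_poly size_Mmonic ?monicXsubC // size_XsubC addn2 /= => <-.
have [L [j [t [hj tab rt]]]] := IH K g (i a) (i b) sg iab gab.
exists L, (j \o i), t; split=> //; first exact: order_embedding_comp.
by rewrite map_poly_comp Eg rmorphM rootM rt.
Qed.

(** * Ultraproducts and the real closure of an ordered field *)

(** Along such an ultrafilter, models of the finite subsets of a set of
constraints glue to a model of all of them. *)
Lemma finite_sets_ultrafilter (T : eqType) :
  exists U : set_system (seq T),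
    UltraFilter U /\ forall t, U [set s : seq T | t \in s].
Proof.
pose B := [set P : set (seq T) | exists s0 : seq T, forall s : seq T,
  {subset s0 <= s} -> P s].
have FB : ProperFilter B.
  apply: Build_ProperFilter_ex; first by move=> P [s0 h]; exists s0; apply: h.
  split; first by exists [::].
    move=> P Q [s hs] [t ht]; exists (s ++ t) => r st; split.
      by apply: hs => x xs; apply: st; rewrite mem_cat xs.
    by apply: ht => x xs; apply: st; rewrite mem_cat xs orbT.
  by move=> P Q PQ [s hs]; exists s => r /hs/PQ.
have [U [uU BU]] := ultraFilterLemma FB.
exists U; split=> // t; apply: BU; exists [:: t] => s; apply.
exact: mem_head.
Qed.

Section Ultraproduct.
Variables (I : Type) (U : set_system I) (uU : UltraFilter U).
Variables (F : I -> realFieldType) (T : Type) (e : forall i, T -> F i).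
Variables (zero one : T) (add mul : T -> T -> T) (opp inv : T -> T).
Hypothesis e0 : U [set i | e i zero = 0].
Hypothesis e1 : U [set i | e i one = 1].
Hypothesis eD : forall x y, U [set i | e i (add x y) = e i x + e i y].
Hypothesis eM : forall x y, U [set i | e i (mul x y) = e i x * e i y].
Hypothesis eN : forall x, U [set i | e i (opp x) = - e i x].
Hypothesis eV : forall x, U [set i | e i (inv x) = (e i x)^-1].

Definition ultra_le x y := U [set i | e i x <= e i y].

Let UI (P Q : I -> Prop) : U [set i | P i] -> U [set i | Q i] ->
  U [set i | P i /\ Q i].
Proof. exact: filterI. Qed.
Let US (P Q : I -> Prop) : (forall i, P i -> Q i) ->
  U [set i | P i] -> U [set i | Q i].
Proof. by move=> PQ; apply: filterS. Qed.

Lemma ultra_not (P : I -> Prop) : ~ U [set i | P i] -> U [set i | ~ P i].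
Proof. by move=> nP; have [] := in_ultra_setVsetC [set i | P i] uU. Qed.

Let eqvP x y : le_eqv ultra_le x y <-> U [set i | e i x = e i y].
Proof.
split=> [[xy yx]|E]; first by apply: US (UI xy yx) => i [h h']; apply/le_anti/andP.
by split; apply: US E => i /= ->.
Qed.

Lemma ultra_presentation :
  ordered_field_presentation ultra_le zero one add mul opp inv.
Proof.
have nz : ~ U [set i : I | False].
  move=> U0; have /filter_ex[i []] : U set0 by apply: filterS U0.
split; rewrite /ultra_le.
- by move=> y x z xy yz; apply: US (UI xy yz) => i [h h']; apply: le_trans h h'.
- move=> x y; have [h|/ultra_not h] := pselect (U [set i | e i x <= e i y]).
    by left.
  by right; apply: US h => i /negP; rewrite -ltNge => /ltW.
- move=> x y z; apply/eqvP.
  apply: US (UI (UI (eD x (add y z)) (eD y z)) (UI (eD (add x y) z) (eD x y))).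
  by move=> i /= [[-> ->] [-> ->]]; rewrite addrA.
- move=> x y; apply/eqvP; apply: US (UI (eD x y) (eD y x)) => i /= [-> ->].
  by rewrite addrC.
- by move=> x; apply/eqvP; apply: US (UI (eD zero x) e0) => i /= [-> ->]; rewrite add0r.
- move=> x; apply/eqvP; apply: US (UI (UI (eD (opp x) x) (eN x)) e0).
  by move=> i /= [[-> ->] ->]; rewrite addNr.
- move=> x y z; apply/eqvP.
  apply: US (UI (UI (eM x (mul y z)) (eM y z)) (UI (eM (mul x y) z) (eM x y))).
  by move=> i /= [[-> ->] [-> ->]]; rewrite mulrA.
- move=> x y; apply/eqvP; apply: US (UI (eM x y) (eM y x)) => i /= [-> ->].
  by rewrite mulrC.
- by move=> x; apply/eqvP; apply: US (UI (eM one x) e1) => i /= [-> ->]; rewrite mul1r.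
- move=> x y z; apply/eqvP.
  apply: US (UI (UI (eM (add x y) z) (eD x y))
                (UI (eD (mul x z) (mul y z)) (UI (eM x z) (eM y z)))).
  by move=> i /= [[-> ->] [-> [-> ->]]]; rewrite mulrDl.
- move=> /eqvP E; apply: nz; apply: US (UI E (UI e0 e1)) => i [E' [E0 E1]].
  by move/eqP: E'; rewrite E0 E1 oner_eq0.
- move=> x nx; have /ultra_not h : ~ U [set i | e i x = 0].
    by move=> x0; apply/nx/eqvP; apply: US (UI x0 e0) => i [-> ->].
  apply/eqvP; apply: US (UI h (UI e1 (UI (eM (inv x) x) (eV x)))).
  by move=> i /= [/eqP x0 [-> [-> ->]]]; rewrite mulVf.
- move=> z x y xy; apply: US (UI xy (UI (eD x z) (eD y z))) => i /= [xy' [-> ->]].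
  by rewrite lerD2r.
- move=> x y x0 y0; apply: US (UI e0 (UI (eM x y) (UI x0 y0))).
  by move=> i /= [-> [-> [h h']]]; rewrite mulr_ge0.
- move=> z x y /eqvP E; apply/eqvP; apply: US (UI E (UI (eM x z) (eM y z))).
  by move=> i /= [-> [-> ->]].
Qed.

(** T is a type of names for elements of the product, so that the whole
ultrapower and the part of an ultraproduct named by formal terms are both
covered.  The hypothesis provides a name for a root whenever, index by index,
the polynomial changes sign; this is the intermediate value property of the
quotient. *)
Theorem ultraproduct_rcf :
  (forall cs ta tb, exists r, U [set i | let P := Poly (map (e i) cs) in
     e i ta <= e i tb -> P.[e i ta] <= 0 <= P.[e i tb] ->
     e i ta <= e i r <= e i tb /\ root P (e i r)]) ->
  exists (L : rcfType) (pi : T -> L),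
  [/\ forall q, exists x, pi x = q,
      forall x y, pi x <= pi y <-> ultra_le x y,
      forall x y, pi x = pi y <-> U [set i | e i x = e i y],
      pi zero = 0 /\ pi one = 1 &
      (forall x y, pi (add x y) = pi x + pi y) /\
      (forall x y, pi (mul x y) = pi x * pi y)].
Proof.
move=> eR.
have [K [pi [surj piE [pi0 pi1] [piD piM]]]] := presented_field ultra_presentation.
have piEq x y : pi x = pi y <-> U [set i | e i x = e i y].
  rewrite -eqvP /le_eqv -!piE; split=> [->|[h h']]; first by rewrite lexx.
  exact/le_anti/andP.
(* Horner's rule evaluates polynomials of the quotient on names, so that their *)
(* signs can be read index by index.                                           *)
pose hor cs x := foldr (fun c acc => add (mul acc x) c) zero cs.
have horE cs x : U [set i | e i (hor cs x) = (Poly (map (e i) cs)).[e i x]].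
  elim: cs => [|c cs IH] /=; first by apply: US e0 => i ->; rewrite horner0.
  apply: US (UI (UI (eD (mul (hor cs x) x) c) (eM (hor cs x) x)) IH).
  by move=> i /= [[-> ->] ->]; rewrite horner_cons.
have horpi cs x : pi (hor cs x) = (Poly (map pi cs)).[pi x].
  by elim: cs => [|c cs IH] /=; rewrite ?horner0 // piD piM IH horner_cons.
have ivt : Num.real_closed_axiom K.
  move=> P a b ab sgn.
  have [cs csE] : exists cs, map pi cs = P.
    elim: (polyseq P) => [|c l [cs <-]]; first by exists [::].
    by have [t <-] := surj c; exists (t :: cs).
  have [[ta Ea] [tb Eb]] := (surj a, surj b).
  have PE x : P.[pi x] = pi (hor cs x) by rewrite horpi csE polyseqK.
  have {}ab : U [set i | e i ta <= e i tb] by apply/piE; rewrite Ea Eb.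
  have sa : U [set i | e i (hor cs ta) <= e i zero].
    by apply/piE; rewrite -PE Ea pi0; case/andP: sgn.
  have sb : U [set i | e i zero <= e i (hor cs tb)].
    by apply/piE; rewrite -PE Eb pi0; case/andP: sgn.
  have [r rP] := eR cs ta tb.
  have Ur : U [set i | e i ta <= e i r <= e i tb /\ root (Poly (map (e i) cs)) (e i r)].
    apply: US (UI (UI rP ab) (UI (UI (UI sa sb) e0) (UI (horE cs ta) (horE cs tb)))).
    move=> i /= [[H h] [[[h1 h2] E0] [Ea' Eb']]]; apply: H => //.
    by rewrite -Ea' -Eb' -E0 h1.
  exists (pi r).
    rewrite -Ea -Eb; apply/andP; split; apply/piE; apply: US Ur => i;
    by case=> /andP[].
  rewrite rootE PE -pi0; apply/eqP/piEq.
  apply: US (UI Ur (UI e0 (horE cs r))) => i [[_ /eqP E] [E0 EH]].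
  by rewrite EH E0.
pose L : rcfType := HB.pack (Num.RealField.sort K) (Num.RealField.class K)
  (Num.RealField_isClosed.Build K ivt).
by exists L, pi.
Qed.

End Ultraproduct.

Section RealClosure.
Variable F : realFieldType.

(** Names for the elements of a real closure of F.  [Root p a b] names a root in
[a, b] of the polynomial whose list of coefficients is encoded by p through
[Cons]; coding lists as terms avoids a nested inductive type. *)
Inductive term :=
| Cst of F
| Add of term & term
| Mul of term & term
| Opp of term
| Inv of term
| Cons of term & term
| Root of term & term & term.

HB.instance Definition _ := gen_eqMixin term.

Implicit Types (t u : term).

Fixpoint depth t := match t with
| Cst _ => 0%N
| Add t u | Mul t u | Cons t u => (maxn (depth t) (depth u)).+1
| Opp t | Inv t => (depth t).+1
| Root p t u => (maxn (depth p) (maxn (depth t) (depth u))).+1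
end.

Fixpoint term_coefs t := if t is Cons c p then c :: term_coefs p else [::].

Fixpoint term_of_coefs (s : seq term) :=
  if s is c :: s' then Cons c (term_of_coefs s') else Cst 0.

Lemma term_of_coefsK s : term_coefs (term_of_coefs s) = s.
Proof. by elim: s => //= c s ->. Qed.

Lemma depth_term_coefs t u : u \in term_coefs t -> (depth u < depth t)%N.
Proof.
elim: t u => //= c _ p IH u; rewrite inE ltnS leq_max => /predU1P[->|/IH].
  by rewrite leqnn.
by move=> /ltnW->; rewrite orbT.
Qed.

Section Interpretation.
Variables (K : realFieldType) (i : F -> K) (e : term -> K).

(** The condition at t involves the values at t and at its constituents only, so
that terms can be interpreted one after the other. *)
Definition respects t : Prop := match t with
| Cst a => e t = i a
| Add u v => e t = e u + e v
| Mul u v => e t = e u * e v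
| Opp u => e t = - e u
| Inv u => e t = (e u)^-1
| Cons _ _ => True
| Root p u v => let P := Poly (map e (term_coefs p)) in
    e u <= e v -> P.[e u] <= 0 <= P.[e v] ->
    e u <= e t <= e v /\ root P (e t)
end.
End Interpretation.

(** The premises of the clause for roots must be reflected by j, not only
preserved; therefore j has to be an order embedding. *)
Lemma respects_extend (K L : realFieldType) (i : F -> K) (j : {rmorphism K -> L})
    (e : term -> K) (e' : term -> L) t :
  order_embedding j ->
  e' t = j (e t) -> (forall u, (depth u < depth t)%N -> e' u = j (e u)) ->
  respects i e t -> respects (j \o i) e' t.
Proof.
move=> hj Et Eu; case: t Et Eu => [a|u v|u v|u|u|u v|p u v] //= -> Eu.
- by move->.
- by rewrite !Eu ?ltnS ?leq_max ?leqnn ?orbT // -rmorphD => ->.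
- by rewrite !Eu ?ltnS ?leq_max ?leqnn ?orbT // -rmorphM => ->.
- by rewrite !Eu ?ltnS // -rmorphN => ->.
- by rewrite !Eu ?ltnS // -fmorphV => ->.
rewrite !Eu ?ltnS ?leq_max ?leqnn ?orbT //.
have -> : map e' (term_coefs p) = map j (map e (term_coefs p)).
  rewrite -map_comp; apply/eq_in_map => w /depth_term_coefs pw.
  by rewrite Eu // ltnS leq_max ltnW.
rewrite -map_Poly !horner_map -(rmorph0 j) !embed_le // => H uv sgn.
have [uv' r] := H uv sgn; split=> //.
by rewrite rootE horner_map (eqP r) rmorph0.
Qed.

Record finite_model := FiniteModel {
  model_field : realFieldType;
  model_embed : {rmorphism F -> model_field};
  model_embedP : order_embedding model_embed;
  model_val : term -> model_field
}.

Definition models (m : finite_model) t := respects (model_embed m) (model_val m) t.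

Lemma depth_prem t u : (depth u < depth t)%N -> (u == t) = false.
Proof. by move=> lt; apply/eqP => E; rewrite E ltnn in lt. Qed.

Lemma solve_term (m : finite_model) t :
  exists (L : realFieldType) (j : {rmorphism model_field m -> L}) (v : L),
  order_embedding j /\
  respects (j \o model_embed m) (fun u => if u == t then v else j (model_val m u)) t.
Proof.
case: m => K i hi e /=.
have idem (v : K) : respects i (fun u => if u == t then v else e u) t ->
  exists (L : realFieldType) (j : {rmorphism K -> L}) (v : L),
    order_embedding j /\ respects (j \o i) (fun u => if u == t then v else j (e u)) t.
  by move=> h; exists K, idfun, v.
case: t idem => [a|u v|u v|u|u|u v|p u v] idem.
- by apply: (idem (i a)); rewrite /= eqxx.
- apply: (idem (e u + e v)); rewrite /= eqxx.
  by rewrite !depth_prem //= ltnS leq_max leqnn ?orbT.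
- apply: (idem (e u * e v)); rewrite /= eqxx.
  by rewrite !depth_prem //= ltnS leq_max leqnn ?orbT.
- by apply: (idem (- e u)); rewrite /= eqxx depth_prem //= ltnS.
- by apply: (idem (e u)^-1); rewrite /= eqxx depth_prem //= ltnS.
- by apply: (idem 0).
set t := Root p u v in idem *; set P := Poly (map e (term_coefs p)).
have ut : (u == t) = false by rewrite depth_prem //= ltnS !leq_max leqnn !orbT.
have vt : (v == t) = false by rewrite depth_prem //= ltnS !leq_max leqnn !orbT.
have coefE (L : realFieldType) (j : {rmorphism K -> L}) w :
    Poly (map (fun z => if z == t then w else j (e z)) (term_coefs p)) = map_poly j P.
  rewrite /P map_Poly -map_comp; congr Poly; apply/eq_in_map => z pz /=.
  by rewrite depth_prem //= ltnS leq_max ltnW // depth_term_coefs.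
have [[uv /andP[Pu Pv]]|H] := pselect (e u <= e v /\ P.[e u] <= 0 <= P.[e v]); last first.
  exists K, idfun, 0; split=> //.
  have /= CE := coefE K idfun 0.
  by rewrite /= eqxx ut vt CE map_poly_id // => h h'; case: H.
have [L [j [r [hj uvr rr]]]] : exists (L : realFieldType) (j : {rmorphism K -> L})
    (r : L), [/\ order_embedding j, j (e u) <= r <= j (e v) & root (map_poly j P) r].
  have [Pu0|Pu0] := eqVneq P.[e u] 0.
    exists K, idfun, (e u); split; rewrite /= ?lexx // map_poly_id //.
    exact/eqP.
  have [Pv0|Pv0] := eqVneq P.[e v] 0.
    exists K, idfun, (e v); split; rewrite /= ?lexx ?uv // map_poly_id //.
    exact/eqP.
  apply: adjoin_root_between => //.
  by rewrite nmulr_rlt0 lt_def ?Pv0 // eq_sym Pu0.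
exists L, j, r; split=> //.
by rewrite /= eqxx ut vt coefE.
Qed.

(** A term of maximal depth is a constituent of no other term of the list, hence
its value can be changed without harm to the conditions at the others. *)
Lemma finite_model_exists (s : seq term) :
  exists m, forall t, t \in s -> models m t.
Proof.
pose R t u := (depth u <= depth t)%N.
have Rtr : transitive R by move=> y x z /= xy yz; apply: leq_trans yz xy.
have Rtot : total R by move=> x y; apply: leq_total.
suff: forall s, sorted R s -> exists m, forall t, t \in s -> models m t.
  move=> H; have [|m hm] := H (sort R s); first exact: sort_sorted.
  by exists m => t ts; apply: hm; rewrite mem_sort.
elim=> [_|t s' IH /= ps].
  by exists (@FiniteModel F idfun (fun=> conj id id) (fun=> 0)).
have [m hm] := IH (path_sorted ps).
have [ts'|ts'] := boolP (t \in s').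
  by exists m => u /predU1P[->|]; apply: hm.
have [L [j [v [hj tr]]]] := solve_term m t.
exists (@FiniteModel L (j \o model_embed m)
  (order_embedding_comp (@model_embedP m) hj)
  (fun u => if u == t then v else j (model_val m u))).
move=> u /predU1P[->|us'] //; rewrite /models /=.
apply: respects_extend hj _ _ (hm _ us') => /=.
  by have -> // : (u == t) = false; apply/eqP => ut; case/negP: ts'; rewrite -ut.
move=> w wu; rewrite depth_prem // (leq_trans wu) //.
exact: (allP (order_path_min Rtr ps)).
Qed.

(** The models of finite sets of terms glue to a field in which the condition
holds at every term; the clause for roots makes it real closed. *)
Theorem real_closure_exists :
  exists (L : rcfType) (i : {rmorphism F -> L}), order_embedding i.
Proof.
have [U [uU memU]] := finite_sets_ultrafilter term.
have [M hM] := boolp.choice finite_model_exists.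
pose e s := model_val (M s).
have UI (P Q : seq term -> Prop) : U [set i | P i] -> U [set i | Q i] ->
    U [set i | P i /\ Q i] by apply: filterI.
have US (P Q : seq term -> Prop) : (forall i, P i -> Q i) ->
    U [set i | P i] -> U [set i | Q i] by move=> PQ; apply: filterS.
have eP t : U [set s | models (M s) t] by apply: US (memU t) => s; apply: hM.
have e0 : U [set s | e s (Cst 0) = 0].
  by apply: US (eP (Cst 0)) => s; rewrite /models /= -/(e s) => ->; rewrite rmorph0.
have e1 : U [set s | e s (Cst 1) = 1].
  by apply: US (eP (Cst 1)) => s; rewrite /models /= -/(e s) => ->; rewrite rmorph1.
have eD t u : U [set s | e s (Add t u) = e s t + e s u] by apply: eP (Add t u).
have eM t u : U [set s | e s (Mul t u) = e s t * e s u] by apply: eP (Mul t u).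
have eN t : U [set s | e s (Opp t) = - e s t] by apply: eP (Opp t).
have eV t : U [set s | e s (Inv t) = (e s t)^-1] by apply: eP (Inv t).
have [|L [pi [surj piE piEq [pi0 pi1] [piD piM]]]] :=
    ultraproduct_rcf uU e0 e1 eD eM eN eV.
  move=> cs ta tb; exists (Root (term_of_coefs cs) ta tb).
  apply: US (eP (Root (term_of_coefs cs) ta tb)) => s.
  by rewrite /models /= term_of_coefsK.
pose i a := pi (Cst a).
have cstE a : U [set s | e s (Cst a) = model_embed (M s) a] by apply: eP (Cst a).
have iD a b : i (a + b) = i a + i b.
  rewrite /i -piD; apply/piEq.
  apply: US (UI _ _ (UI _ _ (cstE a) (cstE b)) (UI _ _ (cstE (a + b)) (eD (Cst a) (Cst b)))).
  by move=> s [[-> ->] [-> ->]]; rewrite rmorphD.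
have iB : zmod_morphism (i : F -> L).
  by move=> a b; apply: (addIr (i b : L)); rewrite subrK; have := iD (a - b) b; rewrite subrK => ->.
have iM : monoid_morphism (i : F -> L).
  split=> // a b; rewrite /i -[RHS]piM; apply/piEq.
  apply: US (UI _ _ (UI _ _ (cstE a) (cstE b)) (UI _ _ (cstE (a * b)) (eM (Cst a) (Cst b)))).
  by move=> s [[-> ->] [-> ->]]; rewrite rmorphM.
pose zm := GRing.isZmodMorphism.Build F L (i : F -> L) iB.
pose mm := GRing.isMonoidMorphism.Build F L (i : F -> L) iM.
pose i' : {rmorphism F -> L} := HB.pack (i : F -> L) zm mm.
exists L, i' => x; rewrite -[i' x]/(i x).
have -> : (0 <= i x :> L) = (pi (Cst 0) <= pi (Cst x)) by rewrite pi0.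
split=> [x0|/piE h].
  apply/piE; apply: US (UI _ _ (cstE 0) (cstE x)) => s [-> ->].
  by rewrite (embed_le (@model_embedP (M s))).
have /filter_ex[s [h1 [h2 h3]]] :=
  UI _ _ h (UI _ _ (cstE 0) (cstE x)).
by move: h1; rewrite h2 h3 (embed_le (@model_embedP (M s))).
Qed.

End RealClosure.

(** * Transfer of one existential quantifier between real closed fields *)

Lemma coefs_ratr (F : realFieldType) n i : coefs F n i = ratr (coefs rat n i).
Proof.
have nth_ratr (s : seq rat) : (map ratr s)`_i = ratr s`_i :> F.
  have [lt|le] := ltnP i (size s); first by rewrite (nth_map 0).
  by rewrite !nth_default ?size_map // rmorph0.
rewrite /coefs -nth_ratr -[in RHS]map_comp; congr (_`_i); apply: eq_map => k /=.
set M := castmx _ (invmx (map_mx _ (ctmat n))).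
set N := castmx _ (invmx (map_mx _ (ctmat n))).
have -> : M = map_mx ratr N; last by rewrite mxE.
rewrite /M /N map_castmx map_invmx -map_mx_comp.
congr (castmx _ (invmx _)); apply/matrixP => a b; rewrite !mxE /=.
by rewrite ratr_int.
Qed.

Section CommonSubfield.
Variables (K : realFieldType) (F : rcfType) (i : {rmorphism K -> F}).
Local Notation "p ^i" := (map_poly i p) (at level 2, format "p ^i").

Definition signed_rem (p q : {poly K}) : {poly K} :=
  - (lead_coef q ^+ Pdiv.Ring.rscalp p q) *: Pdiv.Ring.rmodp p q.

Lemma next_mod_map p q : next_mod p^i q^i = (signed_rem p q)^i.
Proof.
rewrite /next_mod /Pdiv.Ring.rscalp /Pdiv.Ring.rmodp redivp_map /=.
by rewrite /signed_rem map_polyZ lead_coef_map rmorphN rmorphXn.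
Qed.

Definition field_comb (sq : seq {poly K}) (sc : seq int) : {poly K} :=
  \prod_(j < size sq) (sq`_j ^+ (comb_exp sc`_j)).

Lemma poly_comb_map (sq : seq {poly K}) sc :
  poly_comb (map (map_poly i) sq) sc = (field_comb sq sc)^i.
Proof.
rewrite /poly_comb /field_comb size_map rmorph_prod; apply: eq_bigr => j _.
by rewrite rmorphXn (nth_map 0).
Qed.

End CommonSubfield.

Section Transfer.
Variables (K : realFieldType) (F1 F2 : rcfType).
Variables (i1 : {rmorphism K -> F1}) (i2 : {rmorphism K -> F2}).
Hypotheses (h1 : order_embedding i1) (h2 : order_embedding i2).
Local Notation m1 := (map_poly i1).
Local Notation m2 := (map_poly i2).

(** Signed remainder sequences are computed in the field of coefficients. *)
Lemma mods_transfer p q : exists s : seq {poly K},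
  mods (m1 p) (m1 q) = map m1 s /\ mods (m2 p) (m2 q) = map m2 s.
Proof.
rewrite /mods !size_map_poly; move: (maxn _ _) => n.
elim: n p q => [|n IH] p q; first by exists [::].
rewrite !map_poly_eq0; have [_|p0] := eqVneq p 0; first by exists [::].
have [s [E1 E2]] := IH q (signed_rem p q); exists (p :: s).
by rewrite !next_mod_map /= E1 E2.
Qed.

Lemma changes_transfer (s : seq K) : changes (map i1 s) = changes (map i2 s).
Proof.
elim: s => //= a s ->; congr (nat_of_bool _ + _)%N.
case: s => [|b s] /=; first by rewrite !mulr0 !ltxx.
by rewrite -!rmorphM -(rmorph0 i1) -(rmorph0 i2) !embed_lt.
Qed.

Lemma taqR_transfer p q : taqR (m1 p) (m1 q) = taqR (m2 p) (m2 q).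
Proof.
rewrite /taqR /changes_mods !deriv_map -!rmorphM.
have [s [-> ->]] := mods_transfer p (p^`() * q).
rewrite /changes_poly /changes_pinfty /changes_minfty -!map_comp.
have lc (F : rcfType) (i : {rmorphism K -> F}) :
    map (lead_coef \o map_poly i) s = map i (map lead_coef s).
  by rewrite -map_comp; apply: eq_map => f /=; rewrite lead_coef_map.
have lcs (F : rcfType) (i : {rmorphism K -> F}) :
    map ((fun f : {poly F} => (-1) ^+ (~~ odd (size f)) * lead_coef f) \o map_poly i) s
    = map i (map (fun f : {poly K} => (-1) ^+ (~~ odd (size f)) * lead_coef f) s).
  rewrite -map_comp; apply: eq_map => f /=.
  by rewrite lead_coef_map size_map_poly rmorphM rmorphXn rmorphN1.
by rewrite !lc !lcs !changes_transfer.
Qed.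

Lemma ccount_weak_transfer p (sq : seq {poly K}) :
  (0 < ccount_weak (m1 p) (map m1 sq)) = (0 < ccount_weak (m2 p) (map m2 sq)).
Proof.
pose tq (F : rcfType) (i : {rmorphism K -> F}) k :=
  taqsR (map_poly i p) (map (map_poly i) sq) k.
have [c [c1 c2]] : exists c : nat -> int, (forall k, tq F1 i1 k = (c k)%:~R) /\
    (forall k, tq F2 i2 k = (c k)%:~R).
  exists (fun k => taqR (m1 p) (m1 (map (field_comb sq) (sg_tab (size sq)))`_k)).
  have E (F : rcfType) (i : {rmorphism K -> F}) k : tq F i k =
      (taqR (map_poly i p) (map_poly i (map (field_comb sq) (sg_tab (size sq)))`_k))%:~R.
    rewrite /tq /taqsR size_map; congr ((taqR _ _)%:~R).
    have [lt|le] := ltnP k (size (sg_tab (size sq))).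
      by rewrite !(nth_map [::]) // poly_comb_map.
    by rewrite !nth_default ?size_map // rmorph0.
  by split=> k; rewrite E // taqR_transfer.
have [r [-> ->]] : exists r : rat,
   ccount_weak (m1 p) (map m1 sq) = ratr r /\ ccount_weak (m2 p) (map m2 sq) = ratr r.
  rewrite /ccount_weak !size_map.
  have [s s1 s2] : exists2 s : rat, 0 = ratr s :> F1 & 0 = ratr s :> F2.
    by exists 0; rewrite rmorph0.
  rewrite {1}s1 {1}s2 {s1 s2}.
  elim: (3 ^ size sq)%N s => [|n IH] s; first by exists s.
  have [r [r1 r2]] := IH ((c n)%:~R * coefs rat (size sq) n + s).
  have E (F : realFieldType) :
      ratr ((c n)%:~R * coefs rat (size sq) n + s) =
      (c n)%:~R * coefs F (size sq) n + ratr s.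
    by rewrite coefs_ratr rmorphD rmorphM /= ratr_int.
  exists r; rewrite -r1 -r2 !E; by split; [rewrite -c1|rewrite -c2].
by rewrite !ltr0q.
Qed.

Lemma rgcdp0_big (F : idomainType) (p : {poly F}) :
  \big[@Pdiv.Ring.rgcdp _/0]_(q <- [:: p]) q = p.
Proof. by rewrite big_cons big_nil Pdiv.Ring.rgcdp0. Qed.

(** The number of roots of p at which given polynomials are positive is a fixed
rational combination of Tarski queries, and these count sign changes among
leading coefficients of signed remainder sequences.  All of this takes place
in the common ordered subfield K. *)
Theorem existential_transfer (p : {poly K}) (sq : seq {poly K}) :
  (exists x, (m1 p).[x] = 0 /\ forall q, q \in sq -> 0 < (m1 q).[x]) ->
  exists x, (m2 p).[x] = 0 /\ forall q, q \in sq -> 0 < (m2 q).[x].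
Proof.
have E (F : rcfType) (i : {rmorphism K -> F}) :
   (exists x, (map_poly i p).[x] = 0 /\ forall q, q \in sq -> 0 < (map_poly i q).[x])
   <-> ccount_gt0 [:: map_poly i p] (map (map_poly i) sq).
  split=> [[x [px qx]]|/ccount_gt0P[x]].
    apply/ccount_gt0P; exists x; rewrite big_cons big_nil px eqxx /= big_map.
    by rewrite big_seq big_all_cond; apply/allP => q _; apply/implyP/qx.
  rewrite big_cons big_nil andbT big_map big_all => /andP[/eqP px /allP qx].
  by exists x.
rewrite !E /ccount_gt0 !rgcdp0_big !map_poly_eq0.
case: eqP => _ /=; last by rewrite ccount_weak_transfer.
rewrite !big_map /bounding_poly !big_map -!rmorph_prod !deriv_map.
rewrite ccount_weak_transfer.
have lc (F : rcfType) (i : {rmorphism K -> F}) q : order_embedding i ->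
    (0 < lead_coef (map_poly i q)) = (0 < lead_coef q).
  by move=> hi; rewrite lead_coef_map -(rmorph0 i) embed_lt.
have lcs (F : rcfType) (i : {rmorphism K -> F}) q : order_embedding i ->
    (0 < (-1) ^+ (size (map_poly i q)).-1 * lead_coef (map_poly i q)) =
    (0 < (-1) ^+ (size q).-1 * lead_coef q).
  move=> hi; rewrite lead_coef_map size_map_poly -(rmorphN1 i) -rmorphXn -rmorphM.
  by rewrite -(rmorph0 i) embed_lt.
have -> : \big[andb/true]_(q <- sq) (0 < lead_coef (m1 q)) =
    \big[andb/true]_(q <- sq) (0 < lead_coef (m2 q)).
  by apply: eq_bigr => q _; rewrite !lc.
have -> : \big[andb/true]_(q <- sq)
      (0 < (-1) ^+ (size (m1 q)).-1 * lead_coef (m1 q)) =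
    \big[andb/true]_(q <- sq) (0 < (-1) ^+ (size (m2 q)).-1 * lead_coef (m2 q)).
  by apply: eq_bigr => q _; rewrite !lcs.
by [].
Qed.

End Transfer.

(** * The Artin-Lang theorem *)

Lemma horner_map_MXaddC (A B : comNzRingType) (f : {rmorphism A -> B}) p c y :
  (map_poly f (p * 'X + c%:P)).[y] = (map_poly f p).[y] * y + f c.
Proof. by rewrite rmorphD rmorphM /= map_polyX map_polyC hornerMXaddC. Qed.

(** Nested univariate polynomials single out the last variable, the one that is
treated at each step of [artin_lang]. *)
Fixpoint iter_poly (R : idomainType) n : idomainType :=
  if n is m.+1 then {poly (iter_poly R m)} : idomainType else R.

Section Evaluation.
Variables (R : idomainType) (S : comNzRingType) (j : {rmorphism R -> S}).

Fixpoint ev (x : nat -> S) n : {rmorphism iter_poly R n -> S} :=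
  match n return {rmorphism iter_poly R n -> S} with
  | 0%N => j
  | m.+1 => horner_morph (fun a => mulrC (x m) (ev x m a))
  end.

Lemma evS x n (p : {poly (iter_poly R n)}) :
  ev x n.+1 p = (map_poly (ev x n) p).[x n].
Proof. by []. Qed.

End Evaluation.

Lemma eq_ev (R : idomainType) (S : comNzRingType) (j k : {rmorphism R -> S}) x y n :
  j =1 k -> (forall l, (l < n)%N -> x l = y l) -> ev j x n =1 ev k y n.
Proof.
move=> jk; elim: n => // n IH xy p; rewrite !evS xy //; congr horner.
by apply: eq_map_poly => c; apply: IH => l ln; apply: xy; apply: ltnW.
Qed.

Lemma ev_comp (R : idomainType) (S S' : comNzRingType) (j : {rmorphism R -> S})
    (f : {rmorphism S -> S'}) x n p :
  f (ev j x n p) = ev (f \o j) (f \o x) n p.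
Proof.
elim: n p => // n IH p; rewrite !evS -horner_map -map_poly_comp.
by congr (_.[_]); apply: eq_map_poly => c; rewrite /= IH.
Qed.

Section ArtinLang.
Variable R : rcfType.

Lemma rcf_order_embedding (F : realFieldType) (i : {rmorphism R -> F}) :
  order_embedding i.
Proof.
have nn x : 0 <= x -> 0 <= i x.
  by move=> /sqr_sqrtr <-; rewrite rmorphXn sqr_ge0.
move=> x; split=> [/nn //|h]; rewrite leNgt; apply/negP => x0.
have := nn (- x); rewrite oppr_ge0 (ltW x0) rmorphN oppr_ge0 => /(_ isT) h'.
have /eqP : i x = 0 by apply/le_anti/andP.
by rewrite fmorph_eq0 lt_eqF.
Qed.

Lemma order_embedding_sgz (K F : realFieldType) (i : {rmorphism K -> F}) :
  order_embedding i -> forall x, sgz (i x) = sgz x.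
Proof.
move=> hi x; case: (sgzP x) => [->|lt|lt]; first by rewrite rmorph0 sgz0.
  by apply/eqP; rewrite sgz_cp0 -(rmorph0 i) embed_lt.
by apply/eqP; rewrite sgz_cp0 -(rmorph0 i) embed_lt.
Qed.

Lemma sign_pullback_cone (A : comPzRingType) (F : realFieldType)
    (phi : {rmorphism A -> F}) : prime_cone [set a | 0 <= phi a].
Proof.
split=> [|x|x y|].
- split=> [x y|x y|x] /=; rewrite ?rmorphD ?rmorphM ?rmorphXn ?sqr_ge0 //.
    exact: addr_ge0.
  exact: mulr_ge0.
- by rewrite /= rmorphN oppr_ge0; apply/orP/le_total.
- rewrite /support /= !rmorphN !oppr_ge0 rmorphM.
  move=> [h h']; have /eqP : phi x * phi y = 0 by apply/le_anti/andP.
  by rewrite mulf_eq0 => /orP[/eqP ->|/eqP ->]; [left|right]; rewrite lexx.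
- by rewrite /= rmorphN1 oppr_ge0 lt_geF ?ltr01.
Qed.

(** The signs at phi X of the members of S are conditions on one unknown over the
ordered fraction field K of the image of D, and K embeds both into L and into
F.  Several equations are merged into the vanishing of a sum of squares. *)
Lemma realize_signs (D : comNzRingType) (L F : rcfType)
    (phi : {rmorphism {poly D} -> L}) (psi : {rmorphism D -> F}) :
  (forall d, sgz (psi d) = sgz (phi d%:P)) ->
  forall S : seq {poly D}, exists y, forall s, s \in S ->
    sgz (map_poly psi s).[y] = sgz (phi s).
Proof.
move=> sgn S; pose phi0 : {rmorphism D -> L} := phi \o polyC.
have [K [k [kP kfrac]]] := cone_field (sign_pullback_cone phi0).
have ge0E (F1 F2 : realFieldType) (a : F1) (b : F2) :
    sgz a = sgz b -> (0 <= a <-> 0 <= b).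
  by move=> E; rewrite -(sgz_ge0 a) -(sgz_ge0 b) E.
have [i1 [E1 hi1]] : exists i : {rmorphism K -> L},
    (forall a, i (k a) = phi0 a) /\ (forall k, 0 <= k <-> 0 <= i k).
  by apply: fraction_morphism => // a; apply: kP.
have [i2 [E2 hi2]] : exists i : {rmorphism K -> F},
    (forall a, i (k a) = psi a) /\ (forall k, 0 <= k <-> 0 <= i k).
  by apply: fraction_morphism => // a; rewrite kP; apply: ge0E; rewrite sgn.
have val1 s : (map_poly i1 (map_poly k s)).[phi 'X] = phi s.
  rewrite [RHS]rmorph_poly_horner -map_poly_comp; congr (_.[_]).
  by apply: eq_map_poly => a; rewrite /= E1.
have map2 s : map_poly i2 (map_poly k s) = map_poly psi s.
  by rewrite -map_poly_comp; apply: eq_map_poly => a; rewrite /= E2.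
pose Z := [seq s <- S | phi s == 0].
pose P := [seq s <- S | 0 < phi s] ++ [seq - s | s <- S & phi s < 0].
have [|y [y0 yP]] := existential_transfer hi1 hi2 (p := map_poly k (\sum_(s <- Z) s ^+ 2))
    (sq := map (map_poly k) P).
  exists (phi 'X); rewrite val1; split.
    rewrite rmorph_sum big1_seq // => s; rewrite mem_filter => /andP[_ /andP[/eqP s0 _]].
    by rewrite rmorphXn s0 expr0n.
  move=> _ /mapP[s sP ->]; rewrite val1; move: sP; rewrite mem_cat.
  move=> /orP[|/mapP[t]]; rewrite mem_filter => /andP[] // t0 _ ->.
  by rewrite rmorphN oppr_gt0.
exists y => s sS; case: (sgzP (phi s)) => [s0|s0|s0].
- apply/eqP; rewrite sgz_eq0; move/eqP: y0; rewrite map2 rmorph_sum /= horner_sum.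
  rewrite psumr_eq0 => [/allP h|t _]; last by rewrite rmorphXn horner_exp sqr_ge0.
  have := h s; rewrite mem_filter s0 eqxx sS => /(_ isT) /=.
  by rewrite rmorphXn horner_exp sqrf_eq0.
- apply/eqP; rewrite sgz_cp0 -map2; apply: yP; apply: map_f.
  by rewrite mem_cat mem_filter s0 sS.
- have E : (map_poly psi s).[y] = - (map_poly psi (- s)).[y].
    by rewrite rmorphN hornerN opprK.
  apply/eqP; rewrite sgz_cp0 E oppr_lt0 -map2; apply: yP.
  apply: map_f; rewrite mem_cat; apply/orP; right; apply: map_f.
  by rewrite mem_filter s0 sS.
Qed.

Lemma ultrapower_exists (I : Type) (U : set_system I) : UltraFilter U ->
  exists (F : rcfType) (pi : (I -> R) -> F),
  [/\ forall q, exists x, pi x = q,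
      forall x, U [set i | sgz (x i) = sgz (pi x)],
      (pi (fun=> 0) = 0 /\ pi (fun=> 1) = 1) &
      (forall x y, pi (fun i => x i + y i) = pi x + pi y) /\
      (forall x y, pi (fun i => x i * y i) = pi x * pi y)].
Proof.
move=> uU; have UT (P : I -> Prop) : (forall i, P i) -> U [set i | P i].
  by move=> h; apply: filterS filterT => i _.
have [|F [pi [surj piE piEq [pi0 pi1] [piD piM]]]] :=
  @ultraproduct_rcf I U uU (fun=> R) (I -> R) (fun i x => x i)
   (fun=> 0) (fun=> 1) (fun x y i => x i + y i) (fun x y i => x i * y i)
   (fun x i => - x i) (fun x i => (x i)^-1)
   (UT _ (fun=> erefl)) (UT _ (fun=> erefl)) (fun x y => UT _ (fun=> erefl))
   (fun x y => UT _ (fun=> erefl)) (fun x => UT _ (fun=> erefl))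
   (fun x => UT _ (fun=> erefl)).
  move=> cs a b.
  have /boolp.choice[r rP] : forall i, exists r,
      let P := Poly [seq x i | x <- cs] in
      a i <= b i -> P.[a i] <= 0 <= P.[b i] -> a i <= r <= b i /\ root P r.
    move=> i /=.
    have [[ab sg]|h] := pselect (a i <= b i /\
        (Poly [seq x i | x <- cs]).[a i] <= 0 <= (Poly [seq x i | x <- cs]).[b i]).
      by have [r] := poly_ivt ab sg; exists r.
    by exists 0 => ab sg; case: h.
  by exists r; apply: UT.
exists F, pi; split=> // x.
have nU (P : I -> Prop) : ~ U [set i | P i] -> U [set i | ~ P i] by apply: ultra_not.
have [x0|x0|x0] := sgzP (pi x).
- move: x0; rewrite -pi0 => /piEq h; apply: filterS h => i /= ->.
  by rewrite sgz0.
- have /nU h : ~ U [set i | x i <= 0].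
    by move=> h; have /piE : ultra_le U (fun i (x : I -> R) => x i) x (fun=> 0) by [];
      rewrite pi0 leNgt x0.
  by apply: filterS h => i /= /negP; rewrite -ltNge => h; apply/eqP; rewrite sgz_cp0.
- have /nU h : ~ U [set i | 0 <= x i].
    by move=> h; have /piE : ultra_le U (fun i (x : I -> R) => x i) (fun=> 0) x by [];
      rewrite pi0 leNgt x0.
  by apply: filterS h => i /= /negP; rewrite -ltNge => h; apply/eqP; rewrite sgz_cp0.
Qed.

(** Induction on n.  By hypothesis, any finite set of polynomials in the first n
variables has the prescribed signs at some point of R^n; in the ultrapower of R
over these finite sets, the resulting point has all prescribed signs at once.
The last coordinate is found in the ultrapower by [realize_signs], and an index
at which the finitely many conditions hold yields a point of R^(n+1). *)
Theorem artin_lang n (L : rcfType) (phi : {rmorphism iter_poly R n -> L})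
    (S : seq (iter_poly R n)) :
  exists x : nat -> R, forall s, s \in S -> sgz (ev idfun x n s) = sgz (phi s).
Proof.
elim: n L phi S => [|n IH] L phi S.
  by exists (fun=> 0) => s _ /=; rewrite order_embedding_sgz //; apply: rcf_order_embedding.
set D := iter_poly R n in IH phi S *.
have [U [uU memU]] := finite_sets_ultrafilter D.
have [X XP] := boolp.choice (IH L (phi \o polyC)).
have [F [pi [surj pisg [pi0 pi1] [piD piM]]]] := ultrapower_exists uU.
pose f (d : D) := pi (fun i => ev idfun (X i) n d).
have fD a b : f (a + b) = f a + f b.
  by rewrite /f -piD; congr pi; apply: funext => i; rewrite rmorphD.
have fB : zmod_morphism f by move=> a b; apply: (addIr (f b)); rewrite -fD !subrK.
have fM : monoid_morphism f.
  split; first by rewrite /f -pi1; congr pi; apply: funext => i; rewrite rmorph1.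
  by move=> a b; rewrite /f -piM; congr pi; apply: funext => i; rewrite rmorphM.
pose zm := GRing.isZmodMorphism.Build D F f fB.
pose mm := GRing.isMonoidMorphism.Build D F f fM.
pose psi : {rmorphism D -> F} := HB.pack f zm mm.
have sgn d : sgz (psi d) = sgz (phi d%:P).
  have [i /= [h1 h2]] :=
    filter_ex (filterI (memU d) (pisg (fun i => ev idfun (X i) n d))).
  by rewrite -[LHS]/(sgz (f d)) /f -h2; apply: XP.
have [y yP] := realize_signs sgn S.
have [eta etaE] := surj y.
have val s : (map_poly psi s).[y] = pi (fun i => (map_poly (ev idfun (X i) n) s).[eta i]).
  elim/poly_ind: s => [|p c IHp].
    by rewrite rmorph0 horner0 -pi0; congr pi; apply: funext => i; rewrite rmorph0 horner0.
  rewrite horner_map_MXaddC IHp -etaE -piM.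
  rewrite -[X in _ + X]/(f c) -piD; congr pi; apply: funext => i.
  by rewrite horner_map_MXaddC.
have UA : U [set i | forall s, s \in S ->
    sgz (map_poly (ev idfun (X i) n) s).[eta i] = sgz (phi s)].
  elim: S yP => [|s S IHS] yP; first by apply: filterS filterT.
  have h1 := IHS (fun t tS => yP t (@mem_behead _ (s :: S) t tS)).
  have h2 := pisg (fun i => (map_poly (ev idfun (X i) n) s).[eta i]).
  apply: filterS (filterI h1 h2) => i /= [h h'] t /predU1P[->|]; last exact: h.
  by rewrite h' -val yP // mem_head.
have [i iP] := filter_ex UA.
exists (fun k => if k == n then eta i else X i k) => s sS.
rewrite evS eqxx -iP //; congr (sgz _.[_]); apply: eq_map_poly => c.
by apply: eq_ev => // k kn; rewrite ltn_eqF.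
Qed.

End ArtinLang.

(** * Hilbert basis theorem and real Nullstellensatz *)

Section IdealLemmas.
Variables (A : comPzRingType) (I : set A).
Hypothesis iI : is_ideal I.
Lemma ideal0 : I 0. Proof. by case: iI. Qed.
Lemma idealD x y : I x -> I y -> I (x + y). Proof. by case: iI => _ + _; apply. Qed.
Lemma idealM a x : I x -> I (a * x). Proof. by case: iI => _ _; apply. Qed.
Lemma idealMr a x : I x -> I (x * a). Proof. by rewrite mulrC; apply: idealM. Qed.
Lemma idealN x : I x -> I (- x). Proof. exact: is_idealN. Qed.
Lemma idealB x y : I x -> I y -> I (x - y).
Proof. by move=> Ix Iy; apply: idealD => //; apply: idealN. Qed.
Lemma ideal_sum (J : Type) (r : seq J) (P : pred J) (F : J -> A) :
  (forall j, P j -> I (F j)) -> I (\sum_(j <- r | P j) F j).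
Proof. by move=> h; apply: big_ind h; [apply: ideal0|apply: idealD]. Qed.
End IdealLemmas.

Lemma kernel_ideal (A : comPzRingType) (B : comPzRingType) (f : {rmorphism A -> B}) :
  is_ideal [set a | f a = 0].
Proof.
split=> [|x y /= fx fy|a x /= fx]; first exact: rmorph0.
  by rewrite rmorphD fx fy addr0.
by rewrite rmorphM fx mulr0.
Qed.

Lemma preimage_ideal (A B : comPzRingType) (f : {rmorphism A -> B}) (I : set B) :
  is_ideal I -> is_ideal [set a | I (f a)].
Proof.
move=> iI; split=> [|x y /= fx fy|a x /= fx]; first by rewrite /= rmorph0; apply: ideal0.
  by rewrite rmorphD; apply: idealD.
by rewrite rmorphM; apply: idealM.
Qed.

(** Being the least ideal that contains s replaces expressions of the elements of
I as linear combinations of s. *)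
Definition generates (A : comPzRingType) (s : seq A) (I : set A) :=
  (forall x, x \in s -> I x) /\
  forall J : set A, is_ideal J -> (forall x, x \in s -> J x) -> I `<=` J.

Definition noetherian (A : comPzRingType) :=
  forall I : set A, is_ideal I -> exists s, generates s I.

Lemma field_noetherian (F : fieldType) : noetherian F.
Proof.
move=> I iI; have [[a [Ia a0]]|h] := pselect (exists a, I a /\ a != 0).
  have I1 : I 1 by rewrite -(mulVf a0); apply: idealM.
  exists [:: 1]; split=> [x /[!inE]/eqP->//|J iJ J1 x _].
  by rewrite -[x]mulr1; apply: idealM => //; apply: J1; rewrite inE.
exists [::]; split=> // J iJ _ x Ix; have [->|x0] := eqVneq x 0.
  exact: ideal0.
by case: h; exists x.
Qed.

Section HilbertBasis.
Variable D : comNzRingType.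

Definition lead_ideal (I : set {poly D}) d : set D :=
  [set c | exists f, [/\ I f, (size f <= d.+1)%N & f`_d = c]].

Lemma lead_ideal_ideal I d : is_ideal I -> is_ideal (lead_ideal I d).
Proof.
move=> iI; split=> [|_ _ [f [If sf <-]] [g [Ig sg <-]]|a _ [f [If sf <-]]].
- by exists 0; rewrite size_poly0 coef0; split=> //; apply: ideal0.
- exists (f + g); rewrite coefD; split=> //; first exact: idealD.
  by rewrite (leq_trans (size_polyD _ _)) // geq_max sf.
- exists (a%:P * f); rewrite coefCM; split=> //; first exact: idealM.
  by rewrite mul_polyC (leq_trans (size_scale_leq _ _)).
Qed.

Lemma lead_ideal_le I d k c : is_ideal I -> (d <= k)%N ->
  lead_ideal I d c -> lead_ideal I k c.
Proof.
move=> iI dk [f [If sf fc]]; exists ('X^(k - d) * f); split.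
- exact: idealM.
- have [->|f0] := eqVneq f 0; first by rewrite mulr0 size_poly0.
  by rewrite mulrC size_mulXn //; lia.
- by rewrite coefXnM ltnNge leq_subr /= subKn.
Qed.

(** The ideals [lead_ideal I d] increase to a finitely generated union, reached at
some stage N.  Lifts of generators of those with d <= N generate I, as they can
cancel the top coefficient of any element of I. *)
Theorem hilbert_basis : noetherian D -> noetherian {poly D}.
Proof.
move=> ND I iI.
have /boolp.choice[G GP] : forall d, exists G : seq {poly D},
    (forall g, g \in G -> I g /\ (size g <= d.+1)%N) /\
    generates (map (fun g : {poly D} => g`_d) G) (lead_ideal I d).
  move=> d; have [s [sI sm]] := ND _ (lead_ideal_ideal d iI).
  have [G [GI Gs]] : exists G : seq {poly D},
      (forall g, g \in G -> I g /\ (size g <= d.+1)%N) /\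
      map (fun g : {poly D} => g`_d) G = s.
    elim: s sI {sm} => [|c s IH] sI; first by exists [::].
    have [|G [GI Gs]] := IH; first by move=> x xs; apply: sI; rewrite inE xs orbT.
    have [f [If sf fc]] := sI c (mem_head _ _).
    exists (f :: G); rewrite /= fc Gs; split=> // g /predU1P[->|/GI//] //.
  by exists G; rewrite Gs.
pose Linf := [set c | exists d, lead_ideal I d c].
have iL : is_ideal Linf.
  split=> [|x y [d xd] [k yk]|a x [d xd]].
  - by exists 0%N; apply: ideal0; apply: lead_ideal_ideal.
  - exists (maxn d k); apply: idealD; first exact: lead_ideal_ideal.
      exact: lead_ideal_le (leq_maxl _ _) xd.
    exact: lead_ideal_le (leq_maxr _ _) yk.
  - by exists d; apply: idealM => //; apply: lead_ideal_ideal.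
have [s [sL sm]] := ND _ iL.
have [N NP] : exists N, forall x, x \in s -> lead_ideal I N x.
  elim: s sL {sm} => [|c s IH] sL; first by exists 0%N.
  have [|N NP] := IH; first by move=> x xs; apply: sL; rewrite inE xs orbT.
  have [d cd] := sL c (mem_head _ _).
  exists (maxn d N) => x /predU1P[->|/NP xN].
    exact: lead_ideal_le (leq_maxl _ _) cd.
  exact: lead_ideal_le (leq_maxr _ _) xN.
have LN c d : lead_ideal I d c -> lead_ideal I N c.
  move=> cd; apply: (sm _ (lead_ideal_ideal N iI) NP); by exists d.
exists (flatten (map G (iota 0 N.+1))); split.
  by move=> g /flattenP[_ /mapP[d _ ->]] /(GP d).1[].
move=> J iJ GJ.
have lift d c : (d <= N)%N -> lead_ideal I d c ->
    exists h, [/\ J h, I h, (size h <= d.+1)%N & h`_d = c].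
  move=> dN; have [GI [_ Gm]] := GP d.
  apply: (Gm [set c | exists h, [/\ J h, I h, (size h <= d.+1)%N & h`_d = c]]).
    have := @lead_ideal_ideal [set h | J h /\ I h] d.
    have iIJ : is_ideal [set h | J h /\ I h].
      split=> [|x y [? ?] [? ?]|a x [? ?]]; split;
        by [apply: ideal0|apply: idealD|apply: idealM].
    move=> /(_ iIJ); congr is_ideal; apply/seteqP; split=> x.
      by move=> [f [[? ?] ? ?]]; exists f.
    by move=> [f [? ? ? ?]]; exists f.
  move=> _ /mapP[g gG ->]; exists g; have [Ig sg] := GI g gG; split=> //.
  apply: GJ; apply/flattenP; exists (G d) => //; apply: map_f.
  by rewrite mem_iota.
suff: forall d f, I f -> (size f <= d)%N -> J f by move=> H f If; apply: H (leqnn _).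
elim=> [f _|d IH f If sf].
  by rewrite leqn0 size_poly_eq0 => /eqP ->; apply: ideal0.
have cf : lead_ideal I d f`_d by exists f.
have [h [Jh Ih sh hd]] : exists h, [/\ J h, I h, (size h <= d.+1)%N & h`_d = f`_d].
  have [dN|Nd] := leqP d N; first exact: lift.
  have [h [Jh Ih sh hN]] := lift N _ (leqnn N) (LN _ _ cf).
  exists ('X^(d - N) * h); split; try exact: idealM.
    have [->|h0] := eqVneq h 0; first by rewrite mulr0 size_poly0.
    by rewrite mulrC size_mulXn //; lia.
  by rewrite coefXnM ltnNge leq_subr /= subKn // ltnW.
rewrite -(subrK h f); apply: idealD => //; apply: IH; first exact: idealB.
apply/leq_sizeP => k dk; rewrite coefB; case: (ltngtP k d) dk => // [dk|->] _.
  by rewrite !nth_default ?subrr // (leq_trans _ dk).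
by rewrite hd subrr.
Qed.

End HilbertBasis.

Lemma iter_poly_noetherian (F : fieldType) n : noetherian (iter_poly F n).
Proof. by elim: n => [|n IH]; [apply: field_noetherian|apply: hilbert_basis]. Qed.

(** If a^m is in I then so is the square of a^k with k = uphalf m, hence a^k. *)
Lemma real_ideal_expn (A : comPzRingType) (I : set A) a m :
  is_real_ideal I -> I (a ^+ m) -> I a.
Proof.
move=> [iI rI]; have [k] := ubnP m; elim: k m => // k IH [|[|m]] mk Ia.
- by rewrite -[a]mulr1; apply: idealM => //; rewrite -(expr0 a).
- by rewrite -[a]expr1.
- apply: (IH (uphalf m.+2)); first by move: mk; rewrite /= !ltnS; lia.
  apply: (rI [:: a ^+ uphalf m.+2]); last by rewrite inE.
  rewrite big_seq1 -exprM muln2.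
  have -> : (uphalf m.+2).*2 = (m.+2 + odd m.+2)%N by lia.
  by rewrite exprD; apply: idealMr.
Qed.

(** Sums of squares plus elements of I form a preordering that contains no
-a^(2m), for otherwise a^m and then a would be in the real ideal I.  The
residue field of a prime cone above it that avoids -a^2 has a real closure,
and this contains a zero of I at which a does not vanish.  Finitely many
generators of I and a then have the same signs at some point of R^n. *)
Theorem real_nullstellensatz (R : rcfType) n (I : set (iter_poly R n)) a :
  is_real_ideal I -> ~ I a ->
  exists x : nat -> R, (forall f, I f -> ev idfun x n f = 0) /\ ev idfun x n a != 0.
Proof.
move=> rI nIa; have [iI sI] := rI.
pose T := [set t | exists (s : seq (iter_poly R n)) b,
  I b /\ t = \sum_(c <- s) c ^+ 2 + b].
have preT : preordering T.
  split=> [_ _ [s [b [Ib ->]]] [t [c [Ic ->]]]|_ _ [s [b [Ib ->]]] [t [c [Ic ->]]]|x].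
  - exists (s ++ t), (b + c); split; first exact: idealD.
    by rewrite big_cat /= addrACA.
  - exists [seq u * v | u <- s, v <- t],
      ((\sum_(u <- s) u ^+ 2) * c + (\sum_(v <- t) v ^+ 2) * b + c * b); split.
      by apply: idealD; [|apply: idealD|]; try apply: idealM.
    rewrite big_allpairs_dep /=.
    have -> : \sum_(u <- s) \sum_(v <- t) (u * v) ^+ 2 =
        (\sum_(u <- s) u ^+ 2) * (\sum_(v <- t) v ^+ 2).
      rewrite mulr_suml; apply: eq_bigr => u _; rewrite mulr_sumr.
      by apply: eq_bigr => v _; rewrite exprMn.
    by ring.
  - by exists [:: x], 0; rewrite big_seq1 addr0; split=> //; apply: ideal0.
have TI f : I f -> T f by move=> If; exists [::], f; rewrite big_nil add0r.
have [||m [s [b [Ib E]]]|Q [TQ cQ nQ]] := @prime_cone_exists _ T (a ^+ 2); first by [].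
- by case: preT.
- apply: nIa; apply: (@real_ideal_expn _ _ _ m) => //.
  apply: (sI (a ^+ m :: s)); last exact: mem_head.
  rewrite big_cons -exprM mulnC exprM -[a ^+ 2 ^+ m]opprK E.
  have -> : - (\sum_(c <- s) c ^+ 2 + b) + \sum_(j <- s) j ^+ 2 = - b by ring.
  exact: idealN.
have [K [k [kP _]]] := cone_field cQ.
have [L [i hi]] := real_closure_exists K.
pose phi : {rmorphism iter_poly R n -> L} := i \o k.
have phiE f : 0 <= phi f <-> Q f by rewrite -kP /= -hi.
have phiI f : I f -> phi f = 0.
  move=> If; apply/le_anti/andP; split; last exact/phiE/TQ/TI.
  by rewrite -oppr_ge0 -rmorphN; apply/phiE/TQ/TI; apply: idealN.
have phia : phi a != 0.
  apply/eqP => a0; apply: nQ; apply/phiE.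
  by rewrite rmorphN rmorphXn a0 expr0n oppr0.
have [g [gI gm]] := iter_poly_noetherian iI.
have [x xP] := artin_lang phi (a :: g).
exists x; split; last by rewrite -sgz_eq0 xP ?mem_head // sgz_eq0.
apply: (gm _ (kernel_ideal (ev idfun x n))) => f fg /=.
by apply/eqP; rewrite -sgz_eq0 xP ?inE ?fg ?orbT // sgz_eq0 phiI //; apply: gI.
Qed.

(** * Lying over and complex points *)

Section PrimeIdeals.
Variables (A : comPzRingType) (N : set A).
Hypothesis pN : is_prime_ideal N.

Lemma prime_ideal : is_ideal N. Proof. by case: pN. Qed.

Lemma prime_expn x n : N (x ^+ n) -> N x.
Proof.
case: pN => _ N1 NM; elim: n => [|n IH]; first by rewrite expr0 => /N1.
by rewrite exprS => /NM[|/IH].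
Qed.

Lemma prime_prod (T : eqType) (s : seq T) (F : T -> A) :
  N (\prod_(i <- s) F i) -> exists2 i, i \in s & N (F i).
Proof.
case: pN => _ N1 NM; elim: s => [|a s IH]; first by rewrite big_nil => /N1.
rewrite big_cons => /NM[h|/IH[i si h]]; first by exists a; rewrite ?mem_head.
by exists i; rewrite // inE si orbT.
Qed.
End PrimeIdeals.

Lemma ideal_subrX (A : comPzRingType) (N : set A) x y n :
  is_ideal N -> N (x - y) -> N (x ^+ n - y ^+ n).
Proof.
move=> iN Nxy; elim: n => [|n IH]; first by rewrite !expr0 subrr; apply: ideal0.
have -> : x ^+ n.+1 - y ^+ n.+1 = x * (x ^+ n - y ^+ n) + y ^+ n * (x - y).
  by rewrite !exprS; ring.
by apply: idealD => //; apply: idealM.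
Qed.

Section LyingOver.
Variables (D B : comPzRingType) (j : {rmorphism D -> B}).

(** Multiplied by a^n, the integral equation of b becomes an equation of a b whose
lower coefficients are divisible by a.  Replacing a b by s modulo N, it shows
that s^n is in Q. *)
Lemma integral_contraction (N : set B) (Q : set D) a s b :
  is_ideal N -> is_prime_ideal Q -> (forall d, N (j d) -> Q d) ->
  integral_over j b -> Q a -> N (j s - j a * b) -> Q s.
Proof.
move=> iN pQ NQ [n [c E]] Qa Ns; have iQ := prime_ideal pQ.
pose t := s ^+ n + \sum_(k < n) c k * a ^+ (n - k) * s ^+ k.
have Et : j t = (j s ^+ n - (j a * b) ^+ n) +
    \sum_(k < n) j (c k) * j a ^+ (n - k) * (j s ^+ k - (j a * b) ^+ k).
  have E' : j a ^+ n * (b ^+ n + \sum_(k < n) j (c k) * b ^+ k) = 0.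
    by rewrite E mulr0.
  rewrite rmorphD rmorph_sum rmorphXn -[LHS]subr0 -[X in _ - X]E'.
  rewrite mulrDr mulr_sumr -exprMn opprD addrACA -sumrB; congr (_ + _).
  apply: eq_bigr => k _; rewrite !rmorphM !rmorphXn mulrBr exprMn; congr (_ - _).
  have -> : j a ^+ n = j a ^+ (n - k) * j a ^+ k by rewrite -exprD subnK // ltnW.
  by ring.
have Qt : Q t.
  apply: NQ; rewrite Et; apply: idealD => //; first exact: ideal_subrX.
  by apply: ideal_sum => // k _; apply: idealM => //; apply: ideal_subrX.
apply: (prime_expn pQ (n := n)).
have -> : s ^+ n = t - \sum_(k < n) c k * a ^+ (n - k) * s ^+ k.
  by rewrite /t addrK.
apply: idealB => //; apply: ideal_sum => // k _; apply: idealMr => //.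
by rewrite -subnSK // exprS mulrCA; apply: idealMr.
Qed.

(** The ideal N is maximal among those that contract into Q.  It contracts onto Q
by [integral_contraction]. *)
Theorem lying_over (Q : set D) : (forall b, integral_over j b) ->
  is_prime_ideal Q -> (forall d, j d = 0 -> Q d) ->
  exists N, is_prime_ideal N /\ forall d, N (j d) <-> Q d.
Proof.
move=> intB pQ kerQ; have iQ := prime_ideal pQ; have [_ Q1 QM] := pQ.
pose P N := is_ideal N /\ forall d, N (j d) -> Q d.
have [||N [_ [iN NQ] Nmax]] := @zorn_above B P [set 0].
- split=> [|d /kerQ //]; split=> [//|x y -> ->|a x ->]; by rewrite ?addr0 ?mulr0.
- move=> F [X0 FX0] FP Ftot; split; last by move=> d [X /FP[_ h]]; apply: h.
  split=> [|x y [X FX Xx] [Y FY Yy]|a x [X FX Xx]].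
  + by exists X0 => //; apply: ideal0; have [] := FP _ FX0.
  + have [XY|XY] := Ftot _ _ FX FY.
      by exists Y => //; apply: idealD => //; [have [] := FP _ FY|apply: XY].
    by exists X => //; apply: idealD => //; [have [] := FP _ FX|apply: XY].
  + by exists X => //; apply: idealM => //; have [] := FP _ FX.
have ext x : ~ N x -> exists s b, ~ Q s /\ N (j s - x * b).
  move=> nNx; apply: contrapT => H.
  pose N' := [set y | exists b, N (y - x * b)].
  have N'E : N' = N.
    apply: Nmax; first by move=> y Ny; exists 0; rewrite mulr0 subr0.
    split; last by move=> d [b Nb]; apply: contrapT => nQ; apply: H; exists d, b.
    split=> [|y z [b Ny] [c Nz]|a y [b Ny]].
    - by exists 0; rewrite mulr0 subr0; apply: ideal0.
    - exists (b + c); rewrite (_ : _ - _ = (y - x * b) + (z - x * c)); last by ring.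
      exact: idealD.
    - exists (a * b); rewrite (_ : _ - _ = a * (y - x * b)); last by ring.
      exact: idealM.
  by apply: nNx; rewrite -N'E; exists 1; rewrite mulr1 subrr; apply: ideal0.
exists N; split; last first.
  move=> d; split=> [/NQ //|Qd]; apply: contrapT => /ext[s [b [nQs Nb]]].
  exact/nQs/(integral_contraction iN pQ NQ (intB b) Qd Nb).
split=> // [N1|x y Nxy]; first by apply/Q1/NQ; rewrite rmorph1.
apply: contrapT => /not_orP[/ext[s [b [nQs Nb]]] /ext[t [c [nQt Nc]]]].
have [] : Q s \/ Q t; last by []; last by [].
apply/QM/NQ; rewrite rmorphM.
have -> : j s * j t = (j s - x * b) * j t + x * b * (j t - y * c) + b * c * (x * y).
  by ring.
apply: idealD => //; last exact: idealM.
by apply: idealD => //; [apply: idealMr|apply: idealM].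
Qed.

End LyingOver.

(** Let N be a prime over the kernel of h.  The integral equation of b splits over
O, and its roots lift to D; one of the factors b - j e lies in N, and b is sent
to h e. *)
Lemma extend_surjective (O : closedFieldType) (D B : comNzRingType)
    (j : {rmorphism D -> B}) (h : {rmorphism D -> O}) :
  (forall b, integral_over j b) -> (forall w, exists d, h d = w) ->
  (forall d, j d = 0 -> h d = 0) ->
  exists z : {rmorphism B -> O}, forall d, z (j d) = h d.
Proof.
move=> intB surj kerh.
have pQ : is_prime_ideal [set d | h d = 0].
  split; first exact: kernel_ideal.
    by rewrite /= rmorph1; apply/eqP/oner_neq0.
  by move=> x y /=; rewrite rmorphM => /eqP; rewrite mulf_eq0 =>
    /orP[]/eqP; [left|right].
have [N [pN NE]] := lying_over intB pQ kerh.
have iN := prime_ideal pN.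
have near b : exists e, N (b - j e).
  have [n [c E]] := intB b.
  pose P : {poly D} := 'X^n + \poly_(k < n) (if insub k is Some i then c i else 0).
  have Pb : (map_poly j P).[b] = 0.
    rewrite -[RHS]E rmorphD /= map_polyXn hornerD hornerXn; congr (_ + _).
    rewrite (@horner_coef_wide _ n); last first.
      by rewrite (leq_trans (size_poly _ _)) // size_poly.
    by apply: eq_bigr => k _; rewrite coef_map coef_poly ltn_ord valK.
  have Pm : map_poly h P \is monic.
    rewrite rmorphD /= map_polyXn monicE lead_coefDl ?lead_coefXn //.
    by rewrite size_polyXn ltnS (leq_trans (size_poly _ _)) // size_poly.
  have [r rE] := closed_field_poly_normal (map_poly h P).
  rewrite (monicP Pm) scale1r in rE.
  have [s sE] : exists s, map h s = r.
    elim: {rE} r => [|w r [s <-]]; first by exists [::].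
    by have [d <-] := surj w; exists (d :: s).
  pose Pe := \prod_(e <- s) ('X - e%:P).
  have hPe : map_poly h (P - Pe) = 0.
    have E' : map_poly h Pe = map_poly h P.
      rewrite rE -sE big_map rmorph_prod /=; apply: eq_bigr => e _.
      by rewrite map_polyXsubC.
    by rewrite rmorphB /= E' subrr.
  have : N (map_poly j (P - Pe)).[b].
    rewrite horner_coef; apply: ideal_sum => // k _; apply: idealMr => //.
    by rewrite coef_map; apply/NE; rewrite /= -coef_map hPe coef0.
  rewrite rmorphB hornerD Pb add0r hornerN => /(idealN iN); rewrite opprK.
  rewrite rmorph_prod horner_prod => /(prime_prod pN)[e _].
  by rewrite /= map_polyXsubC hornerXsubC; exists e.
have [f fP] := boolp.choice near.
have hE b e : N (b - j e) -> h (f b) = h e.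
  move=> Nbe; apply/eqP; rewrite -subr_eq0 -rmorphB; apply/eqP/NE.
  have -> : j (f b - e) = (b - j e) - (b - j (f b)) by rewrite rmorphB; ring.
  exact: idealB.
have zB : zmod_morphism (h \o f).
  move=> x y; rewrite /= -rmorphB; apply: hE.
  have -> : x - y - j (f x - f y) = (x - j (f x)) - (y - j (f y)).
    by rewrite rmorphB; ring.
  exact: idealB.
have zM : monoid_morphism (h \o f).
  split; first by rewrite /= -(rmorph1 h); apply: hE; rewrite rmorph1 subrr; apply: ideal0.
  move=> x y; rewrite /= -rmorphM; apply: hE.
  have -> : x * y - j (f x * f y) = y * (x - j (f x)) + j (f x) * (y - j (f y)).
    by rewrite rmorphM; ring.
  by apply: idealD => //; apply: idealM.
pose zm := GRing.isZmodMorphism.Build B O (h \o f) zB.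
pose mm := GRing.isMonoidMorphism.Build B O (h \o f) zM.
pose z : {rmorphism B -> O} := HB.pack (h \o f) zm mm.
by exists z => d; rewrite /= ; apply: hE; rewrite subrr; apply: ideal0.
Qed.

Lemma integral_poly (D B : comNzRingType) (j : {rmorphism D -> B}) :
  (forall b, integral_over j b) ->
  forall p : {poly B}, integral_over (map_poly j) p.
Proof.
move=> intB; pose S := integral_closure (map_poly j).
have SD x y : S x -> S y -> S (x + y).
  move=> Sx Sy; rewrite -[y]opprK -[- y]sub0r; apply: subringB => //.
  apply: subringB => //; rewrite -(subrr 1); apply: subringB; exact: subring1.
elim/poly_ind => [|p c Sp]; first by rewrite -(rmorph0 (map_poly j)); apply: integral_over_id.
apply: SD; first apply: (@subringM _ S) => //.
  by rewrite /S /= -(map_polyX j); apply: integral_over_id.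
have [n [d E]] := intB c; exists n, (fun k => (d k)%:P).
transitivity ((c ^+ n + \sum_(k < n) j (d k) * c ^+ k)%:P); last by rewrite E.
rewrite rmorphD rmorph_sum rmorphXn; congr (_ + _).
by apply: eq_bigr => k _; rewrite /= map_polyC rmorphM rmorphXn.
Qed.

(** Adjoining to both rings a variable that is sent to i makes h surjective and
keeps the extension integral. *)
Lemma extend_to_complex_nz (R : rcfType) (D B : comNzRingType)
    (j : {rmorphism D -> B}) (h : {rmorphism D -> R[i]}) :
  (forall b, integral_over j b) -> (forall r : R, exists d, h d = (r%:C)%C) ->
  (forall d, j d = 0 -> h d = 0) ->
  exists z : {rmorphism B -> R[i]}, forall d, z (j d) = h d.
Proof.
move=> intB real kerh.
pose hX : {rmorphism {poly D} -> R[i]} :=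
  horner_morph (fun a => mulrC 'i%C (h a)).
have hXE p : hX p = (map_poly h p).['i%C] by [].
have [|||z zP] := @extend_surjective R[i] {poly D} {poly B} (map_poly j) hX.
- exact: integral_poly.
- move=> [a b]; have [[d dE] [e eE]] := (real a, real b).
  exists (e%:P * 'X + d%:P); rewrite hXE horner_map_MXaddC map_polyC hornerC.
  rewrite /= dE eE; apply/eqP; rewrite eq_complex /=.
  by apply/andP; split; apply/eqP; ring.
- move=> p jp; rewrite hXE (_ : map_poly h p = 0) ?horner0 //.
  by apply/polyP => k; rewrite coef_map coef0; apply: kerh; rewrite -coef_map jp coef0.
exists (z \o polyC) => d.
by have := zP d%:P; rewrite hXE /= !map_polyC hornerC /=.
Qed.

(** A morphism to the complex numbers whose kernel contains that of j forces D and
B to be nonzero. *)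
Theorem extend_to_complex (R : rcfType) (D B : comPzRingType)
    (j : {rmorphism D -> B}) (h : {rmorphism D -> R[i]}) :
  (forall b, integral_over j b) -> (forall r : R, exists d, h d = (r%:C)%C) ->
  (forall d, j d = 0 -> h d = 0) ->
  exists z : {rmorphism B -> R[i]}, forall d, z (j d) = h d.
Proof.
move=> intB real kerh.
have D1 : (1 : D) != 0.
  by apply/eqP => /(congr1 h)/eqP; rewrite rmorph1 rmorph0 oner_eq0.
have B1 : (1 : B) != 0.
  apply/eqP => B0; have /kerh/eqP : j 1 = 0 by rewrite rmorph1.
  by rewrite rmorph1 oner_eq0.
pose D' : comNzRingType := HB.pack (GRing.ComPzRing.sort D)
  (GRing.ComPzRing.class D) (GRing.PzSemiRing_isNonZero.Build D D1).
pose B' : comNzRingType := HB.pack (GRing.ComPzRing.sort B)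
  (GRing.ComPzRing.class B) (GRing.PzSemiRing_isNonZero.Build B B1).
exact: (@extend_to_complex_nz R D' B' j h intB real kerh).
Qed.

(** * Real points of a variety *)

Lemma factor_surjection (A B S : comPzRingType) (f : {rmorphism A -> B})
    (h : {rmorphism A -> S}) : (forall b, exists a, f a = b) ->
  (forall a, f a = 0 -> h a = 0) ->
  exists h' : {rmorphism B -> S}, forall a, h' (f a) = h a.
Proof.
move=> surj ker; have [g gP] := boolp.choice surj.
have hE a b : f a = b -> h (g b) = h a.
  move=> E; apply/eqP; rewrite -subr_eq0 -rmorphB; apply/eqP/ker.
  by rewrite rmorphB gP E subrr.
have zB : zmod_morphism (h \o g).
  by move=> x y; rewrite /= -rmorphB; apply: hE; rewrite rmorphB !gP.
have zM : monoid_morphism (h \o g).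
  split; first by rewrite /= -(rmorph1 h); apply: hE; rewrite rmorph1.
  by move=> x y; rewrite /= -rmorphM; apply: hE; rewrite rmorphM !gP.
pose zm := GRing.isZmodMorphism.Build B S (h \o g) zB.
pose mm := GRing.isMonoidMorphism.Build B S (h \o g) zM.
pose z : {rmorphism B -> S} := HB.pack (h \o g) zm mm.
by exists z => a; apply: hE.
Qed.

Lemma mpoly_morphism_eq (R : comNzRingType) (S : comPzRingType) n
    (f h : {rmorphism {mpoly R[n]} -> S}) :
  (forall c, f c%:MP = h c%:MP) -> (forall k, f 'X_k = h 'X_k) -> f =1 h.
Proof.
move=> fC fX P; rewrite [P]mpolyE !rmorph_sum; apply: eq_bigr => m _.
rewrite -mul_mpolyC !rmorphM fC mpolyXE_id !rmorph_prod; congr (_ * _).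
by apply: eq_bigr => k _; rewrite !rmorphXn fX.
Qed.

Section IteratedPolynomials.
Variable R : idomainType.

Fixpoint iter_const n : R -> iter_poly R n :=
  match n return R -> iter_poly R n with
  | 0%N => id
  | m.+1 => fun c => (iter_const m c)%:P
  end.

Fixpoint iter_var n (k : nat) : iter_poly R n :=
  match n return iter_poly R n with
  | 0%N => 0
  | m.+1 => if k == m then 'X else (iter_var m k)%:P
  end.

Variables (S : comNzRingType) (j : {rmorphism R -> S}) (x : nat -> S).

Lemma ev_const n c : ev j x n (iter_const n c) = j c.
Proof. by elim: n => //= n IH; rewrite -/(ev j x n.+1 _) evS map_polyC hornerC. Qed.

Lemma ev_var n k : (k < n)%N -> ev j x n (iter_var n k) = x k.
Proof.
elim: n => // n IH; rewrite ltnS evS [iter_var _ _]/=.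
case: (eqVneq k n) => [-> _|kn kn']; first by rewrite map_polyX hornerX.
by rewrite map_polyC hornerC; apply: IH; rewrite ltn_neqAle kn.
Qed.

End IteratedPolynomials.

Definition extend0 (S : nmodType) n (x : 'I_n -> S) (k : nat) : S :=
  if insub k is Some i then x i else 0.

Lemma extend0E (S : nmodType) n (x : 'I_n -> S) (k : 'I_n) : extend0 x k = x k.
Proof. by rewrite /extend0 valK. Qed.

Definition iter_to_mpoly (R : idomainType) n : {rmorphism iter_poly R n -> {mpoly R[n]}} :=
  ev (@mpolyC n R) (extend0 (fun k : 'I_n => 'X_k)) n.

Lemma iter_to_mpoly_surj (R : idomainType) n (P : {mpoly R[n]}) :
  exists f, iter_to_mpoly R n f = P.
Proof.
exists (\sum_(m <- msupp P) iter_const n P@_m * \prod_(k < n) iter_var R n k ^+ m k).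
rewrite [RHS]mpolyE rmorph_sum; apply: eq_bigr => m _.
rewrite rmorphM rmorph_prod /iter_to_mpoly ev_const -mul_mpolyC mpolyXE_id.
congr (_ * _); apply: eq_bigr => k _.
by rewrite rmorphXn ev_var // extend0E.
Qed.

Lemma mmap_iter_to_mpoly (R : idomainType) (S : comNzRingType) n
    (j : {rmorphism R -> S}) (x : 'I_n -> S) f :
  mmap j x (iter_to_mpoly R n f) = ev j (extend0 x) n f.
Proof.
rewrite /iter_to_mpoly ev_comp; apply: eq_ev => [c|l ln] /=; first exact: mmapC.
rewrite /extend0; case: insubP => [k _ _|]; last by rewrite ln.
by rewrite mmapX mmap1U.
Qed.

Lemma preimage_real_ideal (A B : comPzRingType) (f : {rmorphism A -> B}) (I : set B) :
  is_real_ideal I -> is_real_ideal [set a | I (f a)].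
Proof.
move=> [iI rI]; split=> [|s]; first exact: preimage_ideal.
rewrite /= rmorph_sum => h a sa; apply: (rI (map f s)); last exact: map_f.
by rewrite big_map (eq_bigr (fun a => f (a ^+ 2))) // => b _; rewrite rmorphXn.
Qed.

Lemma kernel_real_spec (A : comPzRingType) (F : realFieldType)
    (e : {rmorphism A -> F}) : exists p : real_spec A, forall a, p a <-> e a = 0.
Proof.
have pp : is_prime_ideal [set a | e a = 0].
  split; first exact: kernel_ideal.
    by rewrite /= rmorph1; apply/eqP/oner_neq0.
  by move=> x y /=; rewrite rmorphM => /eqP; rewrite mulf_eq0 =>
    /orP[]/eqP; [left|right].
have rp : is_real_ideal [set a | e a = 0].
  split=> [|s /=]; first exact: kernel_ideal.
  rewrite rmorph_sum => /eqP; rewrite psumr_eq0; last first.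
    by move=> a _; rewrite rmorphXn sqr_ge0.
  by move=> /allP h a /h /=; rewrite rmorphXn sqrf_eq0 => /eqP.
by exists (RealSpec pp rp).
Qed.

Section Points.
Variables (R : realType) (X : real_variety R).
Let A := coord_ring X.

Definition iter_pres : {rmorphism iter_poly R (nvars X) -> A} :=
  pres X \o iter_to_mpoly R (nvars X).

Lemma iter_pres_surj a : exists f, iter_pres f = a.
Proof.
have [P <-] := pres_surj a; have [f <-] := iter_to_mpoly_surj P.
by exists f.
Qed.

(** A relation rather than a function, because an element of A is evaluated
through any polynomial that represents it. *)
Definition evaluation (x : real_points X) (e : {rmorphism A -> R}) :=
  forall P, e (pres X P) = mmap idfun (sval x) P.

Lemma evaluation_exists x : exists e, evaluation x e.
Proof.
have [e eP] := @factor_surjection _ _ _ (pres X) (mmap idfun (sval x) : {rmorphism _ -> _})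
  (@pres_surj _ X) (svalP x).
by exists e.
Qed.

Theorem variety_nullstellensatz (I : set A) a : is_real_ideal I -> ~ I a ->
  exists x e, [/\ evaluation x e, forall b, I b -> e b = 0 & e a != 0].
Proof.
move=> rI nIa; have [f fa] := iter_pres_surj a.
have rJ := preimage_real_ideal iter_pres rI.
have [|x [xI xf]] := @real_nullstellensatz R _ _ f rJ; first by move: nIa; rewrite -fa.
have xE g : mmap idfun (fun k : 'I_(nvars X) => x k) (iter_to_mpoly R _ g) = ev idfun x _ g.
  rewrite mmap_iter_to_mpoly; apply: eq_ev => // l ln; rewrite /extend0.
  by case: insubP => [k _ <-|] //; rewrite ln.
have xP P : pres X P = 0 -> mmap idfun (fun k : 'I_(nvars X) => x k) P = 0.
  have [g <-] := iter_to_mpoly_surj P => g0; rewrite xE; apply: xI.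
  by rewrite /= g0; apply: ideal0; case: rI.
pose y : real_points X := exist _ _ xP.
have [e he] := evaluation_exists y.
have eE g : e (iter_pres g) = ev idfun x _ g by rewrite [LHS]he xE.
exists y, e; split=> // [b|]; last by rewrite -fa eE.
by have [g <-] := iter_pres_surj b; rewrite eE; apply: xI.
Qed.

(** The zero ideal of A is real, since A is presented by a real ideal. *)
Lemma eq0_on_real_points (a : A) :
  (forall x e, evaluation x e -> e a = 0) -> a = 0.
Proof.
move=> h; apply: contrapT => a0.
have [|x [e [he _ /eqP]]] := @variety_nullstellensatz [set b | b = 0] a _ a0.
  split; first by split=> [//|x y -> ->|b x ->]; rewrite ?addr0 ?mulr0.
  move=> s s0 b bs.
  have [g gP] := boolp.choice (@pres_surj _ X).
  have [_ rX] := pres_real X.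
  rewrite /= -(gP b); apply: (rX (map g s)); last exact: map_f.
  rewrite /= big_map rmorph_sum -[RHS]s0; apply: eq_bigr => c _.
  by rewrite rmorphXn gP.
by apply; apply: h he.
Qed.

End Points.

(** * Elements generically rational over a prime *)

Section FiberIdeal.
Variables (D B : comPzRingType) (j : {rmorphism D -> B}) (Q : set D).

(** The intersection of the primes of B over Q.  When B is integral over D, it is
the preimage of the Jacobson radical of the localization of B at Q. *)
Definition fiber_ideal : set B := [set b | forall N : set B,
  is_prime_ideal N -> (forall d, N (j d) <-> Q d) -> N b].

Lemma fiber_ideal_ideal : is_ideal fiber_ideal.
Proof.
split=> [N pN _|x y Vx Vy N pN NQ|a x Vx N pN NQ]; have iN := prime_ideal pN.
- exact: ideal0.
- by apply: idealD => //; [apply: Vx|apply: Vy].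
- by apply: idealM => //; apply: Vx.
Qed.

Lemma fiber_ideal_expn b n : fiber_ideal (b ^+ n) -> fiber_ideal b.
Proof. by move=> Vb N pN NQ; apply: (prime_expn pN (n := n)); apply: Vb. Qed.

Lemma fiber_ideal_base d : Q d -> fiber_ideal (j d).
Proof. by move=> Qd N _ NQ; apply/NQ. Qed.

Lemma fiber_ideal_contraction d : (forall b, integral_over j b) ->
  is_prime_ideal Q -> (forall d, j d = 0 -> Q d) -> fiber_ideal (j d) -> Q d.
Proof.
move=> intB pQ kerQ Vd; have [N [pN NQ]] := lying_over intB pQ kerQ.
by apply/NQ; apply: Vd.
Qed.

End FiberIdeal.

Section MinimalRelation.
Variables (D B : comNzRingType) (j : {rmorphism D -> B}) (Q : set D) (p : B).
Hypothesis pQ : is_prime_ideal Q.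
Local Notation V := (fiber_ideal j Q).
Local Notation eval G := (map_poly j G).[p].

(** F is the analogue of a minimal polynomial of p over the residue field of Q, in
the reduced fibre of B over Q. *)
Lemma minimal_relation : integral_over j p -> exists F : {poly D},
  [/\ ~ Q (lead_coef F), V (eval F) &
   forall G : {poly D}, V (eval G) -> (size G < size F)%N -> forall k, Q G`_k].
Proof.
move=> [n [c E]]; have iQ := prime_ideal pQ; have iV := fiber_ideal_ideal j Q.
have [_ Q1 _] := pQ.
pose ok m := `[< exists F : {poly D},
  [/\ ~ Q (lead_coef F), V (eval F) & size F = m] >].
have exok : exists m, ok m.
  pose F : {poly D} := 'X^n + \poly_(k < n) (if insub k is Some i then c i else 0).
  exists (size F); apply/asboolP; exists F; split=> //.
    rewrite /F lead_coefDl ?lead_coefXn //.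
    by rewrite size_polyXn ltnS size_poly.
  rewrite [X in V X](_ : _ = 0); first exact: ideal0.
  rewrite -[RHS]E rmorphD /= map_polyXn hornerD hornerXn; congr (_ + _).
  rewrite (@horner_coef_wide _ n); last first.
    by rewrite (leq_trans (size_poly _ _)) // size_poly.
  by apply: eq_bigr => k _; rewrite coef_map coef_poly ltn_ord valK.
case: (ex_minnP exok) => m /asboolP[F [lF VF sF]] mmin.
exists F; split=> // G VG sG.
suff: forall d (G : {poly D}), V (eval G) -> (size G <= d)%N -> (d < m)%N ->
    forall k, Q G`_k.
  by move=> H; apply: (H _ G VG (leqnn _)); rewrite -sF.
elim=> [|d IH] {sG}{VG}G VG sG dm k.
  by move: sG; rewrite leqn0 size_poly_eq0 => /eqP ->; rewrite coef0; apply: ideal0.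
(* Otherwise G would be an admissible relation of degree d. *)
have Qd : Q G`_d.
  apply: contrapT => nQ.
  have Gd : size G = d.+1.
    apply/eqP; rewrite eqn_leq sG ltnNge; apply/negP => le.
    by apply: nQ; rewrite nth_default //; apply: ideal0.
  have /mmin : ok d.+1.
    by apply/asboolP; exists G; split=> //; rewrite lead_coefE Gd.
  by rewrite leqNgt dm.
have [->|kd] := eqVneq k d; first by [].
pose G' := G - (G`_d)%:P * 'X^d.
have G'k : G'`_k = G`_k by rewrite coefB coefCM coefXn (negPf kd) mulr0 subr0.
rewrite -G'k; apply: IH; last exact: ltnW.
  rewrite rmorphB rmorphM /= map_polyC map_polyXn hornerD hornerN hornerM hornerC.
  by apply: (idealB iV) => //; apply: (idealMr iV); apply: fiber_ideal_base.
apply/leq_sizeP => l dl; rewrite coefB coefCM coefXn.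
case: (ltngtP l d) dl => // [dl|->] _; last by rewrite mulr1 subrr.
by rewrite mulr0 subr0 nth_default // (leq_trans sG).
Qed.

End MinimalRelation.

(** With d = m + 1 the degree of F, the polynomial (d - 1) F'^2 - d F F''
vanishes if F is a multiple of (X - c)^d. *)
Lemma two_roots (O : closedFieldType) (F : {poly O}) m : size F = m.+2 ->
  (F^`() ^+ 2) *+ m - (F * F^`()^`()) *+ m.+1 != 0 ->
  exists c d, [/\ c != d, root F c & root F d].
Proof.
move=> sF E0; apply: contrapT => H.
have [r rE] := closed_field_poly_normal F.
have F0 : F != 0 by rewrite -size_poly_eq0 sF.
have l0 : lead_coef F != 0 by rewrite lead_coef_eq0.
have rootF c : c \in r -> root F c.
  by move=> cr; rewrite rE rootZ // root_prod_XsubC.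
have sr : size r = m.+1.
  by have := congr1 (fun q : {poly O} => size q) rE; rewrite size_scale // size_prod_XsubC sF => -[].
case: r => [|c r] // in rE rootF sr *.
have rc d : d \in c :: r -> d = c.
  move=> dr; apply/eqP; rewrite eq_sym; apply: contrapT => /negP cd; apply: H.
  by exists c, d; rewrite cd !rootF // mem_head.
pose q := 'X - c%:P.
have FE : F = lead_coef F *: q ^+ m.+1.
  rewrite [LHS]rE -sr; congr (_ *: _).
  elim: (c :: r) rc => [|d s IH] rc; first by rewrite big_nil expr0.
  rewrite big_cons exprS (rc d (mem_head _ _)) IH // => d' d's.
  by apply: rc; rewrite inE d's orbT.
have q' : q^`() = 1 by rewrite derivXsubC.
pose l := (lead_coef F)%:P; rewrite -mul_polyC -/l in FE.
have l' : l^`() = 0 by rewrite derivC.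
have qX k : (q ^+ k.+1)^`() = k.+1%:R * q ^+ k.
  by rewrite deriv_exp q' mul1r mulr_natl.
have natX k : (k%:R : {poly O})^`() = 0 by rewrite -[k%:R]/(1 *+ k) derivMn derivC mul0rn.
have F1 : F^`() = l * (m.+1%:R * q ^+ m).
  by rewrite FE derivM l' mul0r add0r qX.
case/eqP: E0; rewrite F1 derivM l' mul0r add0r derivM natX mul0r add0r FE.
rewrite -[X in X - _]mulr_natl -[X in _ - X]mulr_natl.
case: m {sF sr FE F1} => [|m].
  by rewrite expr0 derivC; ring.
by rewrite qX !exprS; move: (q ^+ m) => u; rewrite -!natr1; ring.
Qed.

(** Let F be a minimal relation of p, of degree d.  If d = 1, it expresses p as a
fraction modulo the fibre ideal.  Let d > 1.  The polynomial E of [two_roots]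
is nonzero modulo Q, for otherwise F'(p)^2 would lie in the fibre ideal and F'
would be a shorter relation.  Choose eps, zero on Q, at which the leading
coefficient of F and some coefficient of E are nonzero: then eps(F) has two
distinct roots.  If w is one of them and G(p) = 0, then the pseudo-remainder of
G by F has its coefficients in Q by minimality, and therefore eps(G)(w) = 0.
So eps extends to a morphism on B that sends p to w, for both roots w. *)
Lemma generically_rational_nz (R : rcfType) (D B : comNzRingType)
    (j : {rmorphism D -> B}) (Q : set D) (p : B)
    (Phi : {rmorphism D -> R[i]} -> Prop) :
  (forall b, integral_over j b) -> is_prime_ideal Q ->
  (forall d, j d = 0 -> Q d) -> (forall m, ~ Q m.+1%:R) ->
  (forall eps, Phi eps -> forall r : R, exists d, eps d = (r%:C)%C) ->
  (forall d, ~ Q d -> exists eps,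
     [/\ Phi eps, forall f, Q f -> eps f = 0 & eps d != 0]) ->
  (forall eps (z1 z2 : {rmorphism B -> R[i]}), Phi eps ->
     (forall d, z1 (j d) = eps d) -> (forall d, z2 (j d) = eps d) ->
     z1 p = z2 p) ->
  exists s a, ~ Q s /\ fiber_ideal j Q (j s * p - j a).
Proof.
move=> intB pQ kerQ char0 real dense const.
have iQ := prime_ideal pQ; have iV := fiber_ideal_ideal j Q; have [_ Q1 QM] := pQ.
have [F [lF VF Fmin]] := minimal_relation pQ (intB p).
have VQ d : fiber_ideal j Q (j d) -> Q d by apply: fiber_ideal_contraction.
case sF : (size F) => [|[|[|m]]].
- by case: lF; rewrite lead_coefE sF nth_default ?sF //; apply: ideal0.
- case: lF; have /eqP/size_poly1P[c _ FE] := sF.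
  by rewrite FE lead_coefC; apply: VQ; move: VF; rewrite FE map_polyC hornerC.
- exists F`_1, (- F`_0); split; first by move: lF; rewrite lead_coefE sF.
  move: VF; rewrite (@horner_coef_wide _ 2); last by rewrite (leq_trans (size_poly _ _)) ?sF.
  rewrite !big_ord_recl big_ord0 !coef_map /= expr0 expr1 mulr1 addr0 rmorphN opprK.
  by rewrite addrC.
exfalso.
pose E := (F^`() ^+ 2) *+ m.+1 - (F * F^`()^`()) *+ m.+2.
have [k Ek] : exists k, ~ Q E`_k.
  apply: contrapT => /forallNP EQ.
  have VE : fiber_ideal j Q (map_poly j E).[p].
    rewrite horner_coef; apply: (ideal_sum iV) => k _; apply: (idealMr iV).
    by rewrite coef_map; apply: fiber_ideal_base; apply: contrapT; apply: EQ.
  have VF' : fiber_ideal j Q (map_poly j (F^`() *+ m.+1)).[p].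
    apply: (@fiber_ideal_expn _ _ _ _ _ 2).
    have -> : (map_poly j (F^`() *+ m.+1)).[p] ^+ 2 =
        m.+1%:R * ((map_poly j E).[p] +
          (map_poly j F).[p] * (map_poly j (F^`()^`() *+ m.+2)).[p]).
      rewrite /E; move: m.+1 m.+2 => a b.
      rewrite !(rmorphB, rmorphMn, rmorphM, rmorphXn) /=.
      rewrite !(hornerD, hornerN, hornerMn, hornerM, horner_exp).
      move: (map_poly j F).[p] (map_poly j F^`()).[p] => f g; ring.
    by apply: (idealM iV); apply: (idealD iV) => //; apply: (idealMr iV).
  have sF' : (size (F^`() *+ m.+1) < size F)%N.
    by rewrite -scaler_nat (leq_ltn_trans (size_scale_leq _ _)) // sF ltnS -ltnS -sF
      lt_size_deriv // -size_poly_eq0 sF.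
  have := Fmin _ VF' sF' m.+1; rewrite coefMn coef_deriv -mulr_natl -[F`__ *+ _]mulr_natl.
  move=> /QM[|/QM[|]]; try exact: char0.
  by move: lF; rewrite lead_coefE sF.
have [eps [Pe eQ en0]] : exists eps, [/\ Phi eps, forall f, Q f -> eps f = 0 &
    eps (lead_coef F * E`_k) != 0].
  by apply: dense => /QM[].
move: en0; rewrite rmorphM mulf_eq0 => /norP[el0 eE0].
have sFe : size (map_poly eps F) = m.+3 by rewrite size_map_poly_id0 ?sF.
have [|c [d [cd rc rd]]] := two_roots sFe.
  have -> : (map_poly eps F)^`() ^+ 2 *+ m.+1 -
     (map_poly eps F * (map_poly eps F)^`()^`()) *+ m.+2 = map_poly eps E.
    by rewrite /E !deriv_map !(rmorphB, rmorphMn, rmorphM, rmorphXn).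
  by apply: contra_neq eE0 => E0; rewrite -coef_map E0 coef0.
pose jp : {rmorphism {poly D} -> B} := horner_morph (fun a => mulrC p (j a)).
have jpC a : jp a%:P = j a by rewrite /jp /= /horner_morph map_polyC hornerC.
have lift w : root (map_poly eps F) w -> exists z : {rmorphism B -> R[i]},
    (forall a, z (j a) = eps a) /\ z p = w.
  move=> rw; pose h : {rmorphism {poly D} -> R[i]} := horner_morph (fun a => mulrC w (eps a)).
  have hC a : h a%:P = eps a by rewrite /h /= /horner_morph map_polyC hornerC.
  have [b|r|G|z zP] := @extend_to_complex R {poly D} B jp h.
  - have [n [a aE]] := intB b; exists n, (fun k => (a k)%:P).
    by rewrite -[RHS]aE; congr (_ + _); apply: eq_bigr => l _; rewrite jpC.
  - by have [a aE] := real _ Pe r; exists a%:P; rewrite hC.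
  - rewrite -[jp G]/((map_poly j G).[p]) -[h G]/((map_poly eps G).[w]) => G0.
    have DE := Pdiv.ComRing.rdivp_eq F G.
    have Vr : fiber_ideal j Q (map_poly j (Pdiv.Ring.rmodp G F)).[p].
      have := congr1 (fun H : {poly D} => (map_poly j H).[p]) DE.
      rewrite /= map_polyZ rmorphD rmorphM /= !(hornerZ, hornerD, hornerM) G0 mulr0.
      move=> /esym/eqP; rewrite addr_eq0 -eqr_oppLR => /eqP <-.
      by apply: (idealN iV); apply: (idealM iV).
    have sr : (size (Pdiv.Ring.rmodp G F) < size F)%N.
      by rewrite Pdiv.Ring.ltn_rmodpN0 // -size_poly_eq0 sF.
    have r0 : map_poly eps (Pdiv.Ring.rmodp G F) = 0.
      by apply/polyP => l; rewrite coef_map coef0; apply: eQ; apply: Fmin Vr sr l.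
    have := congr1 (fun H : {poly D} => (map_poly eps H).[w]) DE.
    rewrite /= map_polyZ rmorphD rmorphM /= r0 !(hornerZ, hornerD, hornerM) horner0.
    rewrite (eqP rw) mulr0 addr0 rmorphXn => /eqP; rewrite mulf_eq0 expf_eq0 (negPf el0).
    by rewrite andbF => /eqP.
  exists z; split=> [a|]; first by rewrite -jpC zP hC.
  have := zP 'X; rewrite -[jp 'X]/((map_poly j 'X).[p]) -[h 'X]/((map_poly eps 'X).[w]).
  by rewrite !map_polyX !hornerX.
have [z1 [z1E z1c]] := lift _ rc; have [z2 [z2E z2d]] := lift _ rd.
by move/eqP: cd; apply; rewrite -z1c -z2d; apply: const Pe z1E z2E.
Qed.

(** As Q is a proper ideal that contains the kernel of j, both rings are
nonzero. *)
Theorem generically_rational (R : rcfType) (D B : comPzRingType)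
    (j : {rmorphism D -> B}) (Q : set D) (p : B)
    (Phi : {rmorphism D -> R[i]} -> Prop) :
  (forall b, integral_over j b) -> is_prime_ideal Q ->
  (forall d, j d = 0 -> Q d) -> (forall m, ~ Q m.+1%:R) ->
  (forall eps, Phi eps -> forall r : R, exists d, eps d = (r%:C)%C) ->
  (forall d, ~ Q d -> exists eps,
     [/\ Phi eps, forall f, Q f -> eps f = 0 & eps d != 0]) ->
  (forall eps (z1 z2 : {rmorphism B -> R[i]}), Phi eps ->
     (forall d, z1 (j d) = eps d) -> (forall d, z2 (j d) = eps d) ->
     z1 p = z2 p) ->
  exists s a, ~ Q s /\ fiber_ideal j Q (j s * p - j a).
Proof.
move=> intB pQ kerQ char0 real dense const; have [iQ Q1 _] := pQ.
have D1 : (1 : D) != 0.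
  by apply/eqP => D0; apply: Q1; rewrite D0; apply: ideal0.
have B1 : (1 : B) != 0.
  by apply/eqP => B0; apply/Q1/kerQ; rewrite rmorph1.
pose D' : comNzRingType := HB.pack (GRing.ComPzRing.sort D)
  (GRing.ComPzRing.class D) (GRing.PzSemiRing_isNonZero.Build D D1).
pose B' : comNzRingType := HB.pack (GRing.ComPzRing.sort B)
  (GRing.ComPzRing.class B) (GRing.PzSemiRing_isNonZero.Build B B1).
exact: (@generically_rational_nz R D' B' j Q p Phi).
Qed.

(** * The normalization and the R-seminormalization *)

Lemma maximal_inverse (A : comPzRingType) (m : set A) x :
  is_maximal_ideal m -> ~ m x -> exists w, m (1 - x * w).
Proof.
move=> [im m1 mmax] nmx; apply: contrapT => H.
pose J := [set y | exists w, m (y - x * w)].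
have JE : J = m.
  apply: mmax.
  - split=> [|y z [v my] [w mz]|a y [w my]].
    + by exists 0; rewrite mulr0 subr0; apply: ideal0.
    + exists (v + w); rewrite (_ : _ - _ = (y - x * v) + (z - x * w)); last by ring.
      exact: idealD.
    + exists (a * w); rewrite (_ : _ - _ = a * (y - x * w)); last by ring.
      exact: idealM.
  - by move=> [w mw]; apply: H; exists w.
  - by move=> y my; exists 0; rewrite mulr0 subr0.
by apply: nmx; rewrite -JE; exists 1; rewrite mulr1 subrr; apply: ideal0.
Qed.

Lemma maximal_prime (A : comPzRingType) (m : set A) :
  is_maximal_ideal m -> is_prime_ideal m.
Proof.
move=> mm; have [im m1 _] := mm; split=> // x y mxy.
have [mx|/(maximal_inverse mm)[w mw]] := pselect (m x); [by left|right].
have -> : y = (1 - x * w) * y + w * (x * y) by ring.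
by apply: idealD => //; [apply: idealMr|apply: idealM].
Qed.

Lemma loc_extend (A : comPzRingType) (S : mulset A) (F : fieldType)
    (z : {rmorphism A -> F}) : (forall s, S s -> z s != 0) ->
  exists zl : {rmorphism loc S -> F},
    forall a (s : denom S), zl (frac a s) = z a / z (dval s).
Proof.
move=> nz; have nzd (s : denom S) : z (dval s) != 0 by apply/nz/denomP.
have /boolp.choice[g gP] : forall x : loc S, exists c : A * denom S, x = frac c.1 c.2.
  by apply: fracW => a s; exists (a, s).
pose f x := z (g x).1 / z (dval (g x).2).
have fE a s : f (frac a s) = z a / z (dval s).
  have /eq_frac[u Su E] := gP (frac a s); rewrite /f.
  apply/eqP; rewrite eqr_div // -!rmorphM -(inj_eq (mulfI (nz u Su))) -!rmorphM.
  by rewrite E.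
have fB : zmod_morphism f.
  elim/fracW=> a s; elim/fracW=> b t; rewrite fracB !fE dvalM rmorphB !rmorphM.
  by rewrite -[in RHS]mulNr addf_div // mulNr.
have fM : monoid_morphism f.
  split; first by rewrite [LHS]fE rmorph1 divr1.
  elim/fracW=> a s; elim/fracW=> b t; rewrite fracM !fE dvalM !rmorphM.
  by rewrite mulf_div.
pose zm := GRing.isZmodMorphism.Build (loc S) F f fB.
pose mm := GRing.isMonoidMorphism.Build (loc S) F f fM.
pose z' : {rmorphism loc S -> F} := HB.pack f zm mm.
by exists z'; apply: fE.
Qed.

(** If z w = c is nonzero, w (2 Re(c) - w) is sent to the positive real |c|^2, of
which the inverse is in the image; so the kernel and w generate the unit
ideal. *)
Lemma kernel_maximal (R : rcfType) (A : comPzRingType) (z : {rmorphism A -> R[i]}) :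
  (forall r : R, exists a, z a = (r%:C)%C) -> is_maximal_ideal [set a | z a = 0].
Proof.
move=> real; split; first exact: kernel_ideal.
  by rewrite /= rmorph1; apply/eqP/oner_neq0.
move=> J iJ J1 kerJ; apply/seteqP; split=> // w Jw; apply: contrapT => /eqP zw.
apply: J1; have [[a b] cE] : exists c : R[i], z w = c by exists (z w).
have n0 : a ^+ 2 + b ^+ 2 != 0.
  apply: contra zw; rewrite paddr_eq0 ?sqr_ge0 // !sqrf_eq0 => /andP[/eqP a0 /eqP b0].
  by rewrite cE a0 b0.
have [[t tE] [u uE]] := (real (a *+ 2), real (a ^+ 2 + b ^+ 2)^-1).
have J2 : J (u * (w * (t - w))) by apply: idealM => //; apply: idealMr.
rewrite -(subrK (u * (w * (t - w))) 1); apply: idealD => //; apply: kerJ.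
rewrite /= rmorphB rmorph1 !rmorphM rmorphB tE uE cE; apply/eqP.
rewrite subr_eq0 eq_complex /=; apply/andP; split; apply/eqP; last by ring.
by rewrite !mul0r subr0; field.
Qed.

Section Normalization.
Variables (R : realType) (X : real_variety R).
Local Notation A := (coord_ring X).
Local Notation B := (norm_ring X).
Local Notation C := (Rsn_ring X).
Local Notation i := (to_norm_ring X).

Lemma to_fraction_ring_inj (a : A) : to_fraction_ring X a = 0 -> a = 0.
Proof.
move=> /eq_frac[u nzu E]; apply: nzu.
by move: E; rewrite !dval1 !mulr1 mulr0.
Qed.

Lemma to_norm_ring_inj (a : A) : i a = 0 -> a = 0.
Proof. by move=> /(congr1 val) /to_fraction_ring_inj. Qed.

Lemma norm_integral (b : B) : integral_over i b.
Proof.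
have [n [c E]] : integral_over (to_fraction_ring X) (val b).
  by have /asboolP := valP b.
exists n, c; apply: val_inj; rewrite rmorphD rmorph_sum rmorphXn [RHS]rmorph0.
by rewrite -[RHS]E; congr (_ + _); apply: eq_bigr => k _; rewrite rmorphM rmorphXn.
Qed.

Lemma Rsn_integral (b : B) :
  integral_over (val : {rmorphism C -> B}) b.
Proof.
have [n [c E]] := norm_integral b.
by exists n, (fun k => to_Rsn_ring X (c k)).
Qed.

(** z is a complex point of Spec B' above the real point with evaluation e. *)
Definition over (B' : comPzRingType) (j : A -> B') (z : B' -> R[i]) (e : A -> R) :=
  forall a, z (j a) = RtoC (e a).

Lemma evaluationC x (e : {rmorphism A -> R}) r :
  evaluation x e -> e (pres X (mpolyC _ r)) = r.
Proof. by move=> ->; rewrite mmapC. Qed.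

Lemma evaluation_real x (e : {rmorphism A -> R}) :
  evaluation x e -> forall r, exists a, RtoC (e a) = RtoC r.
Proof. by move=> xe r; exists (pres X (mpolyC _ r)); rewrite (evaluationC _ xe). Qed.

Lemma complex_lift x (e : {rmorphism A -> R}) : evaluation x e ->
  exists z : {rmorphism B -> R[i]}, over i z e.
Proof.
move=> xe.
have [|||z zP] := @extend_to_complex R A B i (RtoC \o e).
- exact: norm_integral.
- exact: evaluation_real xe.
- by move=> a /to_norm_ring_inj ->; rewrite rmorph0.
by exists z.
Qed.

Lemma over_spoint x (e : {rmorphism A -> R}) (z : {rmorphism B -> R[i]}) :
  evaluation x e -> over i z e ->
  exists z' : norm_complex_points X,
    norm_projC z' = complex_of_real_point x /\ (z' : B -> R[i]) = z.
Proof.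
move=> xe oz.
have base r : z (i (pres X (mpolyC _ r))) = RtoC r by rewrite oz (evaluationC _ xe).
exists (SPoint base); split=> //; apply: eq_exist; apply: funext => k.
by rewrite /proj_coord /= oz xe mmapX mmap1U.
Qed.

(** [generically_rational] is applied to the evaluations at real points of X:
those at zeros of P are dense by the real Nullstellensatz, and p takes equal
values at points with the same image because it is constant on real fibres.
This gives s outside P such that s p - a is in all primes of B over P.  Every
maximal ideal of B_P contracts to such a prime, so p is the sum of a / s and of
the element (s p - a) / s of Rad(B_P). *)
Lemma fiber_constant_Rplus (p : B) : constant_on_real_fibers p -> in_Rplus i p.
Proof.
move=> pconst P; have pP := rspec_prime P; have rP := rspec_real P.
have [iP P1 PM] := pP.
have [|||||||s [a [nPs Vsa]]] := @generically_rational R A B i P p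
   (fun eps => exists x e, evaluation x e /\ forall a, eps a = RtoC (e a)).
- exact: norm_integral.
- exact: pP.
- by move=> d /to_norm_ring_inj ->; apply: ideal0.
- move=> m Pm; apply: P1.
  have -> : 1 = pres X (mpolyC _ (m.+1%:R^-1)) * m.+1%:R.
    rewrite -(rmorph_nat (pres X)) -rmorphM -(rmorph_nat (@mpolyC _ R)) -rmorphM.
    by rewrite mulVf ?pnatr_eq0 // !rmorph1.
  exact: idealM.
- by move=> eps [x [e [xe eE]]] r; have [b <-] := evaluation_real xe r; exists b.
- move=> d nPd; have [x [e [xe eP ed]]] := variety_nullstellensatz rP nPd.
  exists (RtoC \o e); split; first by exists x, e.
    by move=> f /eP /= ->; rewrite rmorph0.
  by rewrite fmorph_eq0.
- move=> eps z1 z2 [x [e [xe eE]]] o1 o2.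
  have [|z1' [p1 <-]] := over_spoint xe (z := z1); first by move=> b; rewrite o1.
  have [|z2' [p2 <-]] := over_spoint xe (z := z2); first by move=> b; rewrite o2.
  apply: pconst; rewrite /preimage /= ?p1 ?p2 //; by exists x.
pose Ss := compl_mulsetP i nPs.
exists (frac (i a) (mk_denom Ss)), (frac (i s * p - i a) (mk_denom Ss)); split.
- by exists a, s, nPs.
- move=> m mm; have [im m1 _] := mm; have pm := maximal_prime mm.
  pose L : {rmorphism B -> loc_at i P} := to_loc (compl_mulset i P).
  have LE b : L b = frac b (denom1 (compl_mulset i P)) by [].
  have unit_m t : ~ P t -> ~ m (L (i t)).
    move=> nPt mt; apply: m1.
    have -> : 1 = frac 1 (mk_denom (compl_mulsetP i nPt)) * L (i t).
      by rewrite LE fracM; apply: eq_frac1; rewrite dvalM !dval1 /dval /=; ring.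
    exact: idealM.
  have iN : is_ideal [set b | m (L b)] := preimage_ideal L im.
  have pN : is_prime_ideal [set b | m (L b)].
    split=> // x y.
    by rewrite /= (rmorphM L); have [_ _] := pm; apply.
  have mNP t : m (L (i t)) -> P t.
    by move=> mt; apply: contrapT => /unit_m.
  have NP t : m (L (i t)) <-> P t.
    split=> [/mNP //|Pt]; apply: contrapT => /(maximal_inverse mm)[w].
    elim/fracW: w => b w mw; have [t2 nPt2 t2E] := denomP w.
    apply: nPt2.
    apply: (integral_contraction iN pP mNP (norm_integral b) Pt).
    change (m (L (i t2 - i t * b))).
    have -> : L (i t2 - i t * b) = L (i t2) *
       (1 - L (i t) * frac b w).
      rewrite mulrBr mulr1 rmorphB; congr (_ - _).
      rewrite !LE [frac (i t) _ * _]fracM [RHS]fracM.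
      by apply: eq_frac1; rewrite !dvalM !dval1 t2E; ring.
    exact: idealM.
  have -> : frac (i s * p - i a) (mk_denom Ss) =
     frac 1 (mk_denom Ss) * L (i s * p - i a).
    by rewrite LE fracM; apply: eq_frac1; rewrite dvalM !dval1 /dval /=; ring.
  by apply: idealM => //; apply: (Vsa _ pN NP).
- transitivity (loc_add (frac (i a) (mk_denom Ss)) (frac (i s * p - i a) (mk_denom Ss))).
    rewrite loc_addE; apply: eq_frac1.
    have dv : dval (mk_denom Ss) = i s by [].
    by rewrite dvalM !dval1 dv; ring.
  by [].
Qed.

(** Let P be the kernel of e.  The extension of z to B_P has a maximal kernel,
which contains Rad(B_P), so that z q is the value at x of a fraction a / s. *)
Lemma Rplus_real_value (q : B) x (e : {rmorphism A -> R}) :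
  in_Rplus i q -> evaluation x e -> exists r : R,
  forall z : {rmorphism B -> R[i]}, over i z e -> z q = RtoC r.
Proof.
move=> Rq xe; have [P PE] := kernel_real_spec e.
have [_ [y [[a [s [nPs ->]]] Jy qE]]] := Rq P.
exists (e a / e s) => z oz.
have [|zl zlE] := @loc_extend _ (compl_mulset i P) _ z.
  by move=> _ [t nPt ->]; rewrite oz fmorph_eq0; apply/eqP => t0; apply/nPt/PE.
have zy : zl y = 0.
  apply: (Jy [set w | zl w = 0]); apply: kernel_maximal => r.
  have [b bE] := evaluation_real xe r.
  by exists (to_loc _ (i b)); rewrite [LHS]zlE /= rmorph1 divr1 oz bE.
have := congr1 zl qE; rewrite rmorphD zy addr0 [zl (to_loc _ _)]zlE zlE.
by rewrite /= rmorph1 divr1 /dval /= !oz -fmorph_div.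
Qed.

End Normalization.

(** * Functions on the real points *)

Section RealPoints.
Variables (R : realType) (X : real_variety R).
Local Notation A := (coord_ring X).
Local Notation B := (norm_ring X).
Local Notation C := (Rsn_ring X).
Local Notation i := (to_norm_ring X).
Local Notation c := (to_Rsn_ring X).

Lemma spoint_over (F : comNzRingType) (j : {rmorphism R -> F}) (B' : comPzRingType)
    (k : {rmorphism A -> B'}) (z : spoint j k) x (e : {rmorphism A -> R}) :
  evaluation x e -> (forall l, proj_coord z l = j (sval x l)) ->
  forall a, z (k a) = j (e a).
Proof.
move=> xe zx a; have [P <-] := pres_surj a.
pose f : {rmorphism {mpoly R[nvars X]} -> F} := z \o k \o pres X.
pose h : {rmorphism {mpoly R[nvars X]} -> F} := j \o e \o pres X.
apply: (@mpoly_morphism_eq _ _ _ f h) => [r|l] /=.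
  by rewrite spoint_base (evaluationC _ xe).
by rewrite -[LHS]/(proj_coord z l) zx xe mmapX mmap1U.
Qed.

Lemma norm_point_over (z : norm_complex_points X) x (e : {rmorphism A -> R}) :
  norm_projC z = complex_of_real_point x -> evaluation x e -> over i z e.
Proof.
move=> /(congr1 sval) E xe; apply: (spoint_over xe) => l.
by rewrite -[RHS]/(sval (complex_of_real_point x) l) -E.
Qed.

Lemma Rsn_point_base (y : Rsn_real_points X) x (e : {rmorphism A -> R}) :
  Rsn_projR y = x -> evaluation x e -> forall a, y (c a) = e a.
Proof.
by move=> <- xe; apply: (spoint_over xe).
Qed.

Lemma RtoC_inj : injective (@RtoC R).
Proof. exact: fmorph_inj. Qed.

(** Since B is integral over C, y extends to a complex point of X' over x, and all
such points give q the same value by [Rplus_real_value]. *)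
Lemma Rsn_point_value (y : Rsn_real_points X) x (e : {rmorphism A -> R}) :
  Rsn_projR y = x -> evaluation x e ->
  forall (z : {rmorphism B -> R[i]}) (q : C), over i z e -> z (val q) = RtoC (y q).
Proof.
move=> yx xe z q oz.
have ybase := Rsn_point_base yx xe.
have [|||z' z'E] := @extend_to_complex R C B (val : {rmorphism C -> B}) (RtoC \o y).
- exact: Rsn_integral.
- move=> r; have [a aE] := evaluation_real xe r.
  by exists (c a); rewrite /= ybase.
- by move=> d d0; rewrite (_ : d = 0) ?rmorph0 //; apply: val_inj; rewrite d0 rmorph0.
have oz' : over i z' e by move=> a; rewrite -[i a]/(val (c a)) z'E /= ybase.
have qR : in_Rplus i (val q) by apply/asboolP/(valP q).
have [r rP] := Rplus_real_value qR xe.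
by rewrite (rP z oz) -(rP z' oz') z'E.
Qed.

Lemma Rsn_point_unique (y y' : Rsn_real_points X) :
  Rsn_projR y = Rsn_projR y' -> forall q, y q = y' q.
Proof.
move=> E q; have [e xe] := evaluation_exists (Rsn_projR y').
have [z oz] := complex_lift xe.
by apply: RtoC_inj; rewrite -(Rsn_point_value E xe q oz) -(Rsn_point_value erefl xe q oz).
Qed.

(** A complex point of X' over x takes real values on C. *)
Lemma Rsn_point_exists x : exists y : Rsn_real_points X, Rsn_projR y = x.
Proof.
have [e xe] := evaluation_exists x; have [z oz] := complex_lift xe.
pose f (q : C) : R := complex.Re (z (val q)).
have fE q : RtoC (f q) = z (val q).
  have qR : in_Rplus i (val q) by apply/asboolP/(valP q).
  by have [r rP] := Rplus_real_value qR xe; rewrite /f (rP z oz).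
have fB : zmod_morphism f.
  by move=> p q; apply: RtoC_inj; rewrite rmorphB !fE [val (p - q)](rmorphB (val : {rmorphism C -> B})) rmorphB.
have fM : monoid_morphism f.
  split; first by apply: RtoC_inj; rewrite fE (rmorph1 (val : {rmorphism C -> B})) !rmorph1.
  by move=> p q; apply: RtoC_inj; rewrite rmorphM !fE [val (p * q)](rmorphM (val : {rmorphism C -> B})) rmorphM.
pose zm := GRing.isZmodMorphism.Build C R f fB.
pose mm := GRing.isMonoidMorphism.Build C R f fM.
pose y : {rmorphism C -> R} := HB.pack f zm mm.
have ybase a : y (c a) = e a by apply: RtoC_inj; rewrite fE -oz.
have base r : y (c (pres X (mpolyC _ r))) = idfun r.
  by rewrite ybase (evaluationC _ xe).
exists (SPoint base); case: x xe => x xP xe; apply: eq_exist; apply: funext => l.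
by rewrite /proj_coord /= -[f _]/(y (c _)) ybase xe mmapX mmap1U.
Qed.

(** Write q = a / s with a and s in A.  Every real point of X lifts to X^{R+}, so a
vanishes at all real points of X, and a = 0 by the real Nullstellensatz. *)
Lemma Rsn_points_dense (q : C) : (forall y : Rsn_real_points X, y q = 0) -> q = 0.
Proof.
move=> q0; have [a [s E]] : exists a (s : denom (nonzerodivisors A)),
    val (val q) = frac a s.
  by elim/fracW: (val (val q)) => a s; exists a, s.
have qs : q * c (dval s) = c a.
  apply: val_inj; apply: val_inj; rewrite !rmorphM /= E.
  by rewrite [LHS]fracM; apply: eq_frac1; rewrite dvalM !dval1; ring.
have a0 : a = 0.
  apply: eq0_on_real_points => x e xe; have [y yx] := Rsn_point_exists x.
  by rewrite -(Rsn_point_base yx xe) -qs rmorphM q0 mul0r.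
apply: val_inj; apply: val_inj; rewrite E a0 !rmorph0.
by apply: eq_frac1; rewrite !mul0r.
Qed.

Lemma pullback_unique f (q q' : C) : pullback_is f q -> pullback_is f q' -> q = q'.
Proof.
move=> fq fq'; apply/eqP; rewrite -subr_eq0; apply/eqP/Rsn_points_dense => y.
by rewrite rmorphB -fq -fq' subrr.
Qed.

Lemma pullback_exists (q : C) : exists f : KRplus X, pullback_is (val f) q.
Proof.
have [y yP] := boolp.choice Rsn_point_exists.
have fP : pullback_is (fun x => y x q) q.
  by move=> y'; apply: Rsn_point_unique; rewrite yP.
have KP : KRplus X (fun x => y x q) by exists q.
by exists (in_subring KP).
Qed.

Lemma Rsn_fiber_constant (q : C) : constant_on_real_fibers (val q).
Proof.
move=> z1 z2 [x _ E1] _ E; have [e xe] := evaluation_exists x.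
have qR : in_Rplus i (val q) by apply/asboolP/(valP q).
have [r rP] := Rplus_real_value qR xe.
rewrite (rP z1) ?(rP z2) //; apply: norm_point_over xe; by rewrite ?E1 // -E E1.
Qed.

End RealPoints.

Theorem corollary3p3 (R : realType) (X : real_variety R) :
  exists Phi : {rmorphism KRplus X -> real_fiber_constant X},
    bijective Phi /\
    forall (f : KRplus X) (q : Rsn_ring X),
      pullback_is (val f) q -> val (Phi f) = val q.
Proof.
have /boolp.choice[Q QP] : forall f : KRplus X, exists q, pullback_is (val f) q.
  by move=> f; apply/asboolP/(valP f).
pose phi (f : KRplus X) : real_fiber_constant X :=
  in_subring (S := real_fiber_constant X) (Rsn_fiber_constant (Q f)).
have QE f q : pullback_is (val f) q -> Q f = q.
  by move=> fq; apply: pullback_unique (QP f) fq.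
have QB f g : Q (f - g) = Q f - Q g.
  by apply: QE => y; rewrite [RHS]rmorphB -!QP.
have QM f g : Q (f * g) = Q f * Q g.
  by apply: QE => y; rewrite [RHS]rmorphM -!QP.
have Q1 : Q 1 = 1 by apply: QE => y; rewrite [RHS]rmorph1.
have phiB : zmod_morphism phi by move=> f g; apply: val_inj; rewrite /= QB.
have phiM : monoid_morphism phi.
  by split=> [|f g]; apply: val_inj; rewrite /= ?Q1 ?QM.
pose zm := GRing.isZmodMorphism.Build (KRplus X) (real_fiber_constant X) phi phiB.
pose mm := GRing.isMonoidMorphism.Build (KRplus X) (real_fiber_constant X) phi phiM.
pose Phi : {rmorphism KRplus X -> real_fiber_constant X} := HB.pack phi zm mm.
exists Phi; split; last by move=> f q /QE <-.
have /boolp.choice[G GP] : forall p : real_fiber_constant X,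
    exists f : KRplus X, val (Q f) = val p.
  move=> p; have pc : constant_on_real_fibers (val p) by apply/asboolP/(valP p).
  have pR : Rplus (to_norm_ring X) (val p) := fiber_constant_Rplus pc.
  have [f fP] := pullback_exists (in_subring pR).
  by exists f; rewrite (QE _ _ fP).
exists G => [f|p]; last by apply: val_inj; apply: GP.
have E : Q (G (Phi f)) = Q f by apply: val_inj; rewrite GP.
apply: val_inj; apply: funext => x; have [y <-] := Rsn_point_exists x.
by rewrite !QP E.
Qed.
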